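(* In Euclidean 3-space $\mathbb{R}^3$ there exists a polyhedron $\mathscr{P}$ with the following properties: (i) $\mathscr{P}$ has only triangular faces, has no self-intersections and is homeomorphic to the sphere $\mathbb{S}^2$; (ii) there exists a flex of $\mathscr{P}$ such that none of the dihedral angles of $\mathscr{P}$ remains constant during this flex.
   Context: Polyhedron: let $M$ be an abstract compact two-dimensional manifold (with or without boundary) glued from a finite number of Euclidean triangles $\Delta_k$, $k=1,\dots,n$, and let $f:M\to\mathbb{R}^3$ be a continuous map whose restriction to each $\Delta_k$ is a linear isometric embedding. Then $f(M)$ is called a polyhedron (or polyhedral surface) in $\mathbb{R}^3$. If $\delta\subset M$ is one of the $\Delta_k$, or a side or a vertex of one of them, then $f(\delta)$ is called a face, an edge or a vertex of $f(M)$, respectively. The polyhedron $f(M)$ has no self-intersections if $f$ is injective. The dihedral angle at an edge is the dihedral angle between the two faces incident to this edge. Flex: a flex of a polyhedron $P$ is a continuous family of polyhedra $\{P_t\}_{t\in[\alpha,\beta)}$ such that $P=P_\alpha$ and, for every $t\in(\alpha,\beta)$, $P_\alpha$ and $P_t$ are combinatorially equivalent and their corresponding faces are congruent, while $P_\alpha$ and $P_t$ themselves are not congruent. A dihedral angle of $P$ remains constant during the flex if the value of the dihedral angle of $P_t$ at the corresponding edge does not depend on $t\in[\alpha,\beta)$. *)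

(* Defs.v *)
(* MathComp / MathComp-Analysis *)
From HB Require Import structures.
From mathcomp Require Import all_boot all_order all_algebra.
From mathcomp Require Import all_classical all_reals all_analysis.
Set Implicit Arguments.
Unset Strict Implicit.
Unset Printing Implicit Defensive.
Import Order.TTheory GRing.Theory Num.Theory.
Import numFieldNormedType.Exports.
Local Open Scope classical_set_scope.
Local Open Scope ring_scope.

Section Euclidean.
Context {R : realType} {n : nat}.
Implicit Types u v x y : 'rV[R]_n.

Definition dot u v : R := \sum_i u 0 i * v 0 i.

(* The library norm `|x| on row vectors is the sup norm; it induces the right
   topology but not the Euclidean metric. *)
Definition enorm u : R := Num.sqrt (dot u u).

Definition edist x y : R := enorm (x - y).

Definition angle u v : R := acos (dot u v / (enorm u * enorm v)).

Definition isometry (g : 'rV[R]_n -> 'rV[R]_n) : Prop :=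
  forall x y, edist (g x) (g y) = edist x y.

Definition congruent (A B : set 'rV[R]_n) : Prop :=
  exists2 g, isometry g & g @` A = B.

End Euclidean.

Definition unit_sphere (R : realType) : set 'rV[R]_3 := [set x | enorm x = 1].

Definition homeomorphic (T U : topologicalType) (A : set T) (B : set U) : Prop :=
  exists (f : T -> U) (g : U -> T),
    [/\ {within A, continuous f}, {within B, continuous g},
        f @` A `<=` B, g @` B `<=` A &
        (forall x, A x -> g (f x) = x) /\ (forall y, B y -> f (g y) = y)].

(* The combinatorics of a surface glued from triangles is recorded by the family
   K of the vertex sets of its triangles, the vertices being labelled by 'I_m.
   The surface itself is the geometric realization of K in barycentric
   coordinates: its points are the x : 'rV[R]_m with nonnegative entries of sum 1
   supported in some s \in K; two triangles are glued along the side or vertex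
   spanned by their common labels. *)
Section Surface.
Context {R : realType} {m : nat}.
Implicit Types (s : {set 'I_m}) (K : {set {set 'I_m}}).

Definition simplex s : set 'rV[R]_m :=
  [set x | [/\ forall i, 0 <= x 0 i, \sum_i x 0 i = 1 &
               forall i, i \notin s -> x 0 i = 0]].

Definition realization K : set 'rV[R]_m :=
  [set x | exists2 s, s \in K & simplex s x].

Definition vertex (i : 'I_m) : 'rV[R]_m := delta_mx 0 i.

Definition half_plane : set 'rV[R]_2 := [set y | 0 <= y 0 0].

Definition surface_with_boundary (M : set 'rV[R]_m) : Prop :=
  forall x, M x -> exists U : set 'rV[R]_m,
    [/\ open U, U x &
        homeomorphic (M `&` U) [set: 'rV[R]_2] \/
        homeomorphic (M `&` U) half_plane].

(* D s lists in its rows the corners of a Euclidean triangle of the plane (only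
   the rows with index in s matter); x |-> x *m D s is then the parametrization
   of that triangle by barycentric coordinates. Its injectivity says that the
   triangle is nondegenerate. The last condition says that sides are glued
   isometrically. *)
Definition euclidean_triangles K (D : {set 'I_m} -> 'M[R]_(m, 2)) : Prop :=
  [/\ forall s, s \in K -> #|s| = 3%N,
      forall s x y, s \in K -> simplex s x -> simplex s y ->
        x *m D s = y *m D s -> x = y &
      forall s s' v w, s \in K -> s' \in K ->
        v \in s -> w \in s -> v \in s' -> w \in s' ->
        edist (row v (D s)) (row w (D s)) = edist (row v (D s')) (row w (D s'))].

Definition linear_on s (f : 'rV[R]_m -> 'rV[R]_3) : Prop :=
  forall x, simplex s x -> f x = \sum_i x 0 i *: f (vertex i).

(* Only the values of f on realization K are relevant. *)
Definition polyhedron K (f : 'rV[R]_m -> 'rV[R]_3) : Prop :=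
  exists D : {set 'I_m} -> 'M[R]_(m, 2),
    [/\ euclidean_triangles K D,
        surface_with_boundary (realization K),
        {within realization K, continuous f} &
        forall s, s \in K ->
          linear_on s f /\
          (forall x y, simplex s x -> simplex s y ->
             edist (f x) (f y) = edist (x *m D s) (y *m D s))].

Definition no_self_intersections K (f : 'rV[R]_m -> 'rV[R]_3) : Prop :=
  forall x y, realization K x -> realization K y -> f x = f y -> x = y.

Definition corresponding_faces_congruent K (f f' : 'rV[R]_m -> 'rV[R]_3) : Prop :=
  forall s, s \in K ->
    exists2 g, isometry g & forall x, simplex s x -> f' x = g (f x).

(* Combinatorially equivalent polyhedra are presented over the same K. *)
Definition flex K (f : 'rV[R]_m -> 'rV[R]_3) (alpha beta : R)
    (F : R -> 'rV[R]_m -> 'rV[R]_3) : Prop :=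
  [/\ alpha < beta,
      forall x, realization K x -> F alpha x = f x,
      forall t, alpha <= t < beta -> polyhedron K (F t),
      forall x, realization K x ->
        {within `[alpha, beta[, continuous (fun t => F t x)} &
      forall t, alpha < t < beta ->
        corresponding_faces_congruent K (F alpha) (F t) /\
        ~ congruent (F alpha @` realization K) (F t @` realization K)].

Definition normal_part (u x : 'rV[R]_3) : 'rV[R]_3 :=
  x - (dot x u / dot u u) *: u.

(* The dihedral angle, in [0, pi], along the edge vw between the faces vwa and
   vwb: the angle between the components of a - v and b - v orthogonal to the
   edge. *)
Definition dihedral_angle (f : 'rV[R]_m -> 'rV[R]_3) (v w a b : 'I_m) : R :=
  let p i := f (vertex i) in
  angle (normal_part (p w - p v) (p a - p v))
        (normal_part (p w - p v) (p b - p v)).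

(* The edge vw is incident to the two distinct faces vwa and vwb. *)
Definition edge_between K (v w a b : 'I_m) : Prop :=
  [/\ uniq [:: v; w; a; b],
      [set v; w; a]%SET \in K & [set v; w; b]%SET \in K].

Definition dihedral_angle_constant (alpha beta : R)
    (F : R -> 'rV[R]_m -> 'rV[R]_3) (v w a b : 'I_m) : Prop :=
  forall t t', alpha <= t < beta -> alpha <= t' < beta ->
    dihedral_angle (F t) v w a b = dihedral_angle (F t') v w a b.

End Surface.

(* Main.v *)
Require Import Defs.
From Stdlib Require Import ZArith.
From HB Require Import structures.
From mathcomp Require Import all_boot all_order all_algebra.
From mathcomp Require Import all_classical all_reals all_analysis.
From mathcomp Require Import ring lra zify ssrZ.
Set Implicit Arguments.
Unset Strict Implicit.
Unset Printing Implicit Defensive.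
Import Order.TTheory GRing.Theory Num.Theory.
Import numFieldNormedType.Exports.
Local Open Scope classical_set_scope.
Local Open Scope ring_scope.

(** A hinge of two triangles CDA and CDE can be completed to a flexible disc by
    a half-turn h exchanging A and E: put C' = h C and D' = h D, and replace the
    two triangles by the six triangles ACD', ECD', ADC', EDC', AC'D', EC'D'.
    This crinkle is a Bricard octahedron with two faces removed, and its
    boundary is the quadrilateral CADE. When E turns about the line CD, every
    axis orthogonal to AE through its midpoint gives again the right lengths for
    AC', AD', EC', ED' and C'D', since h is an isometry exchanging A and E.
    Only |CD'| = |DC'| has to be kept, which is one quadratic equation for the
    direction of the axis in the plane orthogonal to AE. Its root at time 0 is
    simple, so it extends to nearby times ([crinkle_flex]).

    Two crinkles CADE and CBDE, glued along C, E, D, flex with A, B, C, D fixed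
    while E swings about CD. Closing them with the triangles ABC and ABD
    gives Steffen's polyhedron; its dihedral angle at AB, between the two closing
    triangles, is constant. Let a second polyhedron of this kind have the rigid
    tetrahedron ABCF, the hinge BF and a swinging vertex G: its crinkles BAFG and
    BCFG are closed by the triangles ABC and ACF, and its constant angle is at
    AC. Glue the two polyhedra along ABC and delete this triangle. Now every
    edge lies on some triangle of a moving crinkle. The result has 15 vertices,
    26 triangles and 39 edges. Its vertices are labelled C = 0, D = 1, A = 2,
    E = 3, B = 4, F = 5, G = 6; the images of the hinge ends under the four
    half-turns are 7, 8 for CADE, 9, 10 for CBDE, 11, 12 for BAFG and 13, 14 for
    BCFG.

    For explicit integer coordinates, everything reduces to the signs of finitely
    many integers.
    - Embedding: any two triangles are separated by a plane on which one of them
      has only common vertices ([separated_inj], [points_embedded]).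
    - Sphere: the same triangles, on other points, bound a convex polytope; it is
      projected radially to the unit sphere ([convex_sphere], [complex_sphere]),
      and stereographic projection gives the charts ([sphere_surface]).
    - Dihedral angles: as side lengths are kept, the angle at vw between vwa and
      vwb determines |ab| ([dihedral_angle_distance]). The velocities at time 0
      are determined by the rigidity of the sides ([velocities]), and with them
      the derivative of |ab|^2, which vanishes for no edge ([opposite_rate]).
    - Noncongruence: the diameter is |EG| at time 0 ([diameter_points],
      [plmap_diameter]), and |EG| increases at first. *)

(* Euclidean distance and isometries, not the notions of the same names for
   uniform spaces and bilinear forms. *)
Local Notation edist := Defs.edist.
Local Notation isometry := Defs.isometry.

(** * Euclidean vectors *)

Section Dot.
Context {R : realType} {n : nat}.
Implicit Types (u v w x y : 'rV[R]_n) (a : R).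

Lemma dotC u v : dot u v = dot v u.
Proof. by apply: eq_bigr => i _; rewrite mulrC. Qed.

Lemma dotDl u v w : dot (u + v) w = dot u w + dot v w.
Proof. by rewrite -big_split; apply: eq_bigr => i _; rewrite mxE mulrDl. Qed.

Lemma dotZl a u v : dot (a *: u) v = a * dot u v.
Proof. by rewrite mulr_sumr; apply: eq_bigr => i _; rewrite mxE mulrA. Qed.

Lemma dotNl u v : dot (- u) v = - dot u v.
Proof. by rewrite -scaleN1r dotZl mulN1r. Qed.

Lemma dotBl u v w : dot (u - v) w = dot u w - dot v w.
Proof. by rewrite dotDl dotNl. Qed.

Lemma dotDr u v w : dot w (u + v) = dot w u + dot w v.
Proof. by rewrite dotC dotDl !(dotC w). Qed.

Lemma dotZr a u v : dot v (a *: u) = a * dot v u.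
Proof. by rewrite dotC dotZl dotC. Qed.

Lemma dotNr u v : dot u (- v) = - dot u v.
Proof. by rewrite dotC dotNl dotC. Qed.

Lemma dotBr u v w : dot w (u - v) = dot w u - dot w v.
Proof. by rewrite dotDr dotNr. Qed.

Lemma dot0l u : dot 0 u = 0.
Proof. by rewrite -(scale0r 0) dotZl mul0r. Qed.

Lemma dot_suml (I : Type) (r : seq I) (P : pred I) (F : I -> 'rV[R]_n) u :
  dot (\sum_(i <- r | P i) F i) u = \sum_(i <- r | P i) dot (F i) u.
Proof.
elim/big_rec2: _ => [|i x y _ <-]; first exact: dot0l.
by rewrite dotDl.
Qed.

Lemma dot_ge0 u : 0 <= dot u u.
Proof. by apply: sumr_ge0 => i _; rewrite -expr2 sqr_ge0. Qed.

Lemma dot_eq0 u : (dot u u == 0) = (u == 0).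
Proof.
apply/eqP/eqP => [/eqP|->]; last exact: dot0l.
rewrite psumr_eq0 => [/allP uu0|i _]; last by rewrite -expr2 sqr_ge0.
apply/rowP => i; rewrite mxE; apply/eqP.
by have := uu0 i (mem_index_enum _); rewrite /= mulf_eq0 orbb.
Qed.

Lemma dot_gt0 u : (0 < dot u u) = (u != 0).
Proof. by rewrite lt_def dot_eq0 dot_ge0 andbT. Qed.

Lemma cauchy_schwarz u v : dot u v ^+ 2 <= dot u u * dot v v.
Proof.
have [->|v0] := eqVneq v 0; first by rewrite dotC !dot0l mulr0 expr0n.
have := dot_ge0 (dot v v *: u - dot u v *: v).
rewrite dotBl !dotBr !dotZl !dotZr (dotC v u).
have : 0 < dot v v by rewrite dot_gt0.
set a := dot u u; set b := dot u v; set c := dot v v => c0.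
rewrite (_ : _ - _ = c * (a * c - b ^+ 2)); last by ring.
by rewrite pmulr_rge0 // subr_ge0.
Qed.

Lemma enorm_ge0 u : 0 <= enorm u. Proof. exact: sqrtr_ge0. Qed.

Lemma sqr_enorm u : enorm u ^+ 2 = dot u u.
Proof. by rewrite sqr_sqrtr // dot_ge0. Qed.

Lemma enorm_gt0 u : (0 < enorm u) = (u != 0).
Proof. by rewrite sqrtr_gt0 dot_gt0. Qed.

Lemma enormZ a u : enorm (a *: u) = `|a| * enorm u.
Proof.
by rewrite /enorm dotZl dotZr mulrA -expr2 sqrtrM ?sqr_ge0 // sqrtr_sqr.
Qed.

Lemma dot_le_enorm u v : dot u v <= enorm u * enorm v.
Proof.
apply: le_trans (ler_norm _) _.
rewrite -(@ler_pXn2r _ 2) ?nnegrE ?mulr_ge0 ?enorm_ge0 //.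
by rewrite exprMn !sqr_enorm real_normK ?num_real // cauchy_schwarz.
Qed.

Definition sqdist x y : R := dot (x - y) (x - y).

Lemma sqdistC x y : sqdist x y = sqdist y x.
Proof. by rewrite /sqdist -opprB dotNl dotNr opprK. Qed.

(** A triangle's inner products are determined by its side lengths: all
    congruence arguments below go through this identity. *)
Lemma polarization x y (z : 'rV[R]_n) :
  dot (x - z) (y - z) = (sqdist x z + sqdist y z - sqdist x y) / 2.
Proof.
by rewrite /sqdist !(dotBl, dotBr) (dotC y x) (dotC z x) (dotC z y); field.
Qed.

Lemma edist_eq k (x y : 'rV[R]_n) (x' y' : 'rV[R]_k) : 
  edist x y = edist x' y' <-> dot (x - y) (x - y) = dot (x' - y') (x' - y').
Proof.
split=> [/(congr1 (fun a => a ^+ 2))|]; last by rewrite /edist /enorm => ->.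
by rewrite /edist /enorm !sqr_sqrtr // sumr_ge0 // => i _; rewrite -expr2 sqr_ge0.
Qed.

End Dot.

Lemma dot3E (R : realType) (u v : 'rV[R]_3) :
  dot u v = u 0 0 * v 0 0 + u 0 1 * v 0 1 + u 0 (2%:R) * v 0 (2%:R).
Proof.
rewrite /dot !big_ord_recl big_ord0 addr0 addrA.
by congr (u 0 _ * v 0 _ + u 0 _ * v 0 _ + u 0 _ * v 0 _); apply/val_inj.
Qed.

Lemma dot2E (R : realType) (u v : 'rV[R]_2) :
  dot u v = u 0 0 * v 0 0 + u 0 1 * v 0 1.
Proof.
rewrite /dot !big_ord_recl big_ord0 addr0.
by congr (u 0 _ * v 0 _ + u 0 _ * v 0 _); apply/val_inj.
Qed.

Definition row3 (R : realType) (x y z : R) : 'rV[R]_3 :=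
  \row_i [:: x; y; z]`_i.

Definition row2 (R : realType) (x y : R) : 'rV[R]_2 := \row_i [:: x; y]`_i.

Lemma row3P (R : realType) (u v : 'rV[R]_3) :
  u 0 0 = v 0 0 -> u 0 1 = v 0 1 -> u 0 2%:R = v 0 2%:R -> u = v.
Proof.
move=> e0 e1 e2; apply/rowP => -[[|[|[|//]]] ilt].
- by rewrite (_ : Ordinal ilt = 0) //; apply/val_inj.
- by rewrite (_ : Ordinal ilt = 1) //; apply/val_inj.
- by rewrite (_ : Ordinal ilt = 2%:R) //; apply/val_inj.
Qed.

Lemma row2P (R : realType) (u v : 'rV[R]_2) :
  u 0 0 = v 0 0 -> u 0 1 = v 0 1 -> u = v.
Proof.
move=> e0 e1; apply/rowP => -[[|[|//]] ilt].
- by rewrite (_ : Ordinal ilt = 0) //; apply/val_inj.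
- by rewrite (_ : Ordinal ilt = 1) //; apply/val_inj.
Qed.

Lemma row_continuous (R : realType) (T : topologicalType) (n : nat)
    (f : T -> 'rV[R]_n) (x : T) :
  (forall i, continuous_at x (fun t => f t 0 i)) -> continuous_at x f.
Proof.
move=> cf; apply/cvgrPdist_le => /= e e0; near=> t.
rewrite /Num.Def.normr/= mx_normrE (bigmax_le _ (ltW e0))//= => -[i j] _.
rewrite !mxE/= (ord1 i); move: j; near: t; apply: filter_forall => /= j.
exact: ((cvgrPdist_le _ _).1 (cf j)).
Unshelve. all: by end_near. Qed.

Lemma continuous_at_sum (R : realType) (V : normedModType R)
    (T : topologicalType) (I : finType) (F : I -> T -> V) (x : T) :
  (forall i, continuous_at x (F i)) ->
  continuous_at x (fun t => \sum_i F i t).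
Proof.
move=> cF; rewrite /continuous_at; elim: (index_enum _) => [|i r IHr].
  by under eq_fun do rewrite big_nil; rewrite big_nil; exact: cvg_cst.
under eq_fun do rewrite big_cons; rewrite big_cons.
by apply: cvgD; [exact: cF|exact: IHr].
Qed.

Lemma row2_continuous (R : realType) (T : topologicalType) (f g : T -> R) x :
  continuous_at x f -> continuous_at x g ->
  continuous_at x (fun t => row2 (f t) (g t)).
Proof.
move=> cf cg; apply: row_continuous => i; rewrite /continuous_at mxE.
under eq_fun do rewrite mxE; case: i => -[|[|//]] ilt //=.
Qed.

Lemma row3_continuous (R : realType) (T : topologicalType) (f g h : T -> R) x :
  continuous_at x f -> continuous_at x g -> continuous_at x h ->
  continuous_at x (fun t => row3 (f t) (g t) (h t)).
Proof.
move=> cf cg ch; apply: row_continuous => i.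
rewrite /continuous_at mxE.
under eq_fun do rewrite mxE; case: i => -[|[|[|//]]] ilt //=.
Qed.

Lemma row3E (R : realType) (x y z : R) :
  (row3 x y z 0 0 = x) * (row3 x y z 0 1 = y) * (row3 x y z 0 2%:R = z).
Proof. by rewrite !mxE. Qed.

Lemma row2E (R : realType) (x y : R) :
  (row2 x y 0 0 = x) * (row2 x y 0 1 = y).
Proof. by rewrite !mxE. Qed.

Section RealContinuity.
Context {R : realType} {T : topologicalType}.
Implicit Types (f g : T -> R) (x : T).

Lemma for_continuousD f g x : continuous_at x f -> continuous_at x g ->
  continuous_at x (fun t => f t + g t).
Proof. exact: cvgD. Qed.

Lemma for_continuousB f g x : continuous_at x f -> continuous_at x g ->
  continuous_at x (fun t => f t - g t).
Proof. exact: cvgB. Qed.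

Lemma for_continuousM f g x : continuous_at x f -> continuous_at x g ->
  continuous_at x (fun t => f t * g t).
Proof. exact: cvgM. Qed.

Lemma for_continuousV f x : f x != 0 -> continuous_at x f ->
  continuous_at x (fun t => (f t)^-1).
Proof. exact: cvgV. Qed.

Lemma for_continuous_cst (U : topologicalType) (a : U) x :
  continuous_at x (fun=> a).
Proof. exact: cvg_cst. Qed.

Lemma for_continuousZ (V : normedModType R) f (g : T -> V) x :
  continuous_at x f -> continuous_at x g ->
  continuous_at x (fun t => f t *: g t).
Proof. exact: cvgZ. Qed.

Lemma for_continuous_sqrt f x : continuous_at x f ->
  continuous_at x (fun t => Num.sqrt (f t)).
Proof. by move=> cf; apply: continuous_comp cf _; exact: sqrt_continuous. Qed.

Lemma for_continuous_coord (n : nat) (f : T -> 'rV[R]_n) (i : 'I_n) x :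
  continuous_at x f -> continuous_at x (fun t => f t 0 i).
Proof.
move=> cf; exact: (@continuous_comp _ _ _ f (fun M : 'rV_n => M 0 i) x cf
  (@coord_continuous _ _ _ 0 i (f x))).
Qed.

End RealContinuity.

(** * Homeomorphisms *)

Section Homeomorphic.
Implicit Types T U V : topologicalType.

Lemma within_continuous_comp2 T U V (A : set T) (B : set U)
    (f : T -> U) (g : U -> V) :
  {within A, continuous f} -> {within B, continuous g} -> f @` A `<=` B ->
  {within A, continuous (g \o f)}.
Proof.
move=> /subspace_continuousP cf /subspace_continuousP cg fAB.
apply/subspace_continuousP => x Ax.
apply: cvg_trans (cg (f x) _); last by apply: fAB; exists x.
move=> P BP; have : nbhs x [set y | A y -> B (f y) -> P (g (f y))].
  exact: cf x Ax _ BP.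
apply: (@filterS _ (nbhs x)) => y BPy Ay /=.
by apply: BPy => //; apply: fAB; exists y.
Qed.

Lemma homeomorphic_sym T U (A : set T) (B : set U) :
  homeomorphic A B -> homeomorphic B A.
Proof. by case=> f [g [cf cg fAB gBA [gf fg]]]; exists g, f; split. Qed.

Lemma homeomorphic_trans T U V (A : set T) (B : set U) (C : set V) :
  homeomorphic A B -> homeomorphic B C -> homeomorphic A C.
Proof.
move=> [f [g [cf cg fAB gBA [gf fg]]]] [h [k [ch ck hBC kCB [kh hk]]]].
exists (h \o f), (g \o k); split.
- exact: within_continuous_comp2 cf ch fAB.
- exact: within_continuous_comp2 ck cg kCB.
- by move=> _ [x Ax <-]; apply: hBC; exists (f x) => //; apply: fAB; exists x.
- by move=> _ [x Ax <-]; apply: gBA; exists (k x) => //; apply: kCB; exists x.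
- split=> x xP /=; first by rewrite kh ?gf //; apply: fAB; exists x.
  by rewrite fg ?hk //; apply: kCB; exists x.
Qed.

Lemma homeomorphic_restrict T U (A A' : set T) (B B' : set U) f g :
  [/\ {within A, continuous f}, {within B, continuous g},
      f @` A `<=` B, g @` B `<=` A &
      (forall x, A x -> g (f x) = x) /\ (forall y, B y -> f (g y) = y)] ->
  A' `<=` A -> B' `<=` B -> f @` A' `<=` B' -> g @` B' `<=` A' ->
  homeomorphic A' B'.
Proof.
move=> [cf cg _ _ [gf fg]] AA BB fAB gBA; exists f, g; split=> //.
- exact: continuous_subspaceW cf.
- exact: continuous_subspaceW cg.
- by split=> x xP; [apply: gf; apply: AA|apply: fg; apply: BB].
Qed.

(** The inverse is continuous because closed subsets of A are compact, so that
    their images are closed. *)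
Lemma compact_inj_homeomorphic T U (A : set T) (f : T -> U) :
  T -> hausdorff_space U ->
  compact A -> {within A, continuous f} ->
  (forall x y, A x -> A y -> f x = f y -> x = y) ->
  homeomorphic A (f @` A).
Proof.
move=> t0 hU cA cf injf.
pose g y := xget t0 [set x | A x /\ f x = y].
have gK x : A x -> g (f x) = x.
  move=> Ax; rewrite /g; case: xgetP => [z _ [Az /injf->]//|].
  by move/(_ x); case.
exists f, g; split=> //.
- apply/continuous_closedP => Z clZ; apply/closed_subspaceP.
  exists (f @` (A `&` Z)).
    apply: (compact_closed hU); apply: continuous_compact.
      by apply: continuous_subspaceW cf => x [].
    exact: compact_closedI.
  rewrite eqEsubset; split=> y.
    by move=> [[x [Ax Zx] <-] _]; split; [change (Z (g (f x))); rewrite gK|exists x].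
  by move=> [Zgy [x Ax xy]]; split; exists x=> //; split=> //;
    move: Zgy; rewrite -xy => Zgy; have : Z (g (f x)) := Zgy; rewrite gK.
- by move=> _ [_ [x Ax <-] <-]; rewrite gK.
- by split=> [|_ [x Ax <-]]; [exact: gK|rewrite gK].
Qed.

End Homeomorphic.

(** * Stereographic projection *)

Section Stereographic.
Context {R : realType}.
Implicit Types (x : 'rV[R]_3) (y : 'rV[R]_2) (e : R).

(** For e = 1 and e = -1 this is the projection from the pole (0, 0, e) onto the
    equatorial plane. *)
Definition stereo e x : 'rV[R]_2 :=
  row2 (x 0 0 / (1 - e * x 0 2%:R)) (x 0 1 / (1 - e * x 0 2%:R)).

Definition stereo_inv e y : 'rV[R]_3 :=
  let s := y 0 0 ^+ 2 + y 0 1 ^+ 2 in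
  row3 (2 * y 0 0 / (s + 1)) (2 * y 0 1 / (s + 1)) (e * (s - 1) / (s + 1)).

Lemma unit_sphereE x : unit_sphere x <->
  x 0 0 ^+ 2 + x 0 1 ^+ 2 + x 0 2%:R ^+ 2 = 1.
Proof.
rewrite /unit_sphere /= !expr2 -dot3E -sqr_enorm; split=> [->|/eqP].
  by rewrite expr1n.
by rewrite sqrf_eq1 => /orP[/eqP//|/eqP xN1]; have := enorm_ge0 x; rewrite xN1 oppr_ge0 ler10.
Qed.

Lemma stereo_homeomorphic e : e ^+ 2 = 1 ->
  homeomorphic (@unit_sphere R `&` [set x | x 0 2%:R != e]) [set: 'rV[R]_2].
Proof.
move=> e1.
have e0 : e != 0 by apply/eqP => e0; move: e1; rewrite e0 expr0n /= => /eqP; rewrite eq_sym oner_eq0.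
have dn0 x : x 0 2%:R != e -> 1 - e * x 0 2%:R != 0.
  move=> /eqP xe; apply/eqP => d0; apply: xe; apply: (mulfI e0).
  by rewrite -expr2 e1; apply/esym/eqP; rewrite -subr_eq0 d0.
have sp y : y 0 0 ^+ 2 + y 0 1 ^+ 2 + 1 != 0 by rewrite gt_eqF // ltr_wpDl // addr_ge0 ?sqr_ge0.
exists (stereo e), (stereo_inv e); split.
- apply/continuous_in_subspaceT => x; rewrite inE => -[_ /= xe].
  have cx i : continuous_at x (fun z : 'rV[R]_3 => z 0 i) by exact: coord_continuous.
  have cd : continuous_at x (fun z : 'rV[R]_3 => (1 - e * z 0 2%:R)^-1).
    apply: for_continuousV; first exact: dn0.
    apply: for_continuousB; first exact: for_continuous_cst.
    by apply: for_continuousM; [exact: for_continuous_cst|exact: cx].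
  by apply: row2_continuous; apply: for_continuousM.
- apply/continuous_subspaceT => y.
  have cy i : continuous_at y (fun z : 'rV[R]_2 => z 0 i) by exact: coord_continuous.
  have cs a : continuous_at y (fun y : 'rV[R]_2 => y 0 0 ^+ 2 + y 0 1 ^+ 2 + a).
    apply: for_continuousD; last exact: for_continuous_cst.
    by apply: for_continuousD; exact: for_continuousM.
  have cd : continuous_at y (fun y : 'rV[R]_2 => (y 0 0 ^+ 2 + y 0 1 ^+ 2 + 1)^-1).
    by apply: for_continuousV; [exact: sp|exact: cs].
  have c2 i : continuous_at y (fun y : 'rV[R]_2 => 2 * y 0 i).
    by apply: for_continuousM; [exact: for_continuous_cst|exact: cy].
  by rewrite /stereo_inv; apply: row3_continuous; apply: for_continuousM => //;
    apply: for_continuousM; [exact: for_continuous_cst|exact: cs].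
- by [].
- move=> _ [y _ <-]; have := sp y; rewrite /stereo_inv; set s := y 0 0 ^+ 2 + _.
  move=> s0; split; last first.
    rewrite /= row3E; apply/eqP => /(congr1 (fun a => e * a * (s + 1))).
    rewrite (_ : e * (_ / _) * _ = e ^+ 2 * (s - 1)); last by field.
    by rewrite -expr2 e1 => E; lra.
  apply/unit_sphereE; rewrite !row3E.
  rewrite (_ : _ + _ = (4 * s + e ^+ 2 * (s - 1) ^+ 2) / (s + 1) ^+ 2); last by rewrite /s; field.
  by rewrite e1; field.
- split=> [x [/unit_sphereE x1 /= xe]|y _].
    have d0 := dn0 _ xe.
    rewrite /stereo /stereo_inv !row2E; move: x1 d0.
    set a := x 0 0; set b := x 0 1; set c := x 0 2%:R => x1 d0.
    have dn1 : 2 * (1 - e * c) != 0 by rewrite mulf_neq0 // pnatr_eq0.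
    have es : (a / (1 - e * c)) ^+ 2 + (b / (1 - e * c)) ^+ 2 + 1 = 2 / (1 - e * c).
      rewrite (_ : _ + 1 = (a ^+ 2 + b ^+ 2 + 1 - 2 * (e * c) + e ^+ 2 * c ^+ 2) /
        (1 - e * c) ^+ 2); last by field.
      have -> : a ^+ 2 + b ^+ 2 = 1 - c ^+ 2 by rewrite -x1; ring.
      by rewrite e1; field.
    have es' : (a / (1 - e * c)) ^+ 2 + (b / (1 - e * c)) ^+ 2 - 1 = 2 * (e * c) / (1 - e * c).
      have -> : forall z : R, z - 1 = (z + 1) - 2 by move=> z; ring.
      by rewrite es; field.
    apply: row3P; rewrite row3E ?es ?es' -/a -/b -/c; [by field|by field|].
    transitivity (e ^+ 2 * c); first by field.
    by rewrite e1 mul1r.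
  have s0 := sp y; rewrite /stereo /stereo_inv !row3E.
  have -> : 1 - e * (e * (y 0 0 ^+ 2 + y 0 1 ^+ 2 - 1) / (y 0 0 ^+ 2 + y 0 1 ^+ 2 + 1)) = 2 / (y 0 0 ^+ 2 + y 0 1 ^+ 2 + 1).
    rewrite (_ : e * (_ / _) = e ^+ 2 * (y 0 0 ^+ 2 + y 0 1 ^+ 2 - 1) / (y 0 0 ^+ 2 + y 0 1 ^+ 2 + 1)); last by field.
    by rewrite e1; field.
  by apply: row2P; rewrite row2E; field.
Qed.

End Stereographic.

(** Any point of the sphere is different from one of the poles (0, 0, 1) and
    (0, 0, -1), and the complement of that pole is a plane. *)
Lemma sphere_surface (R : realType) m (M : set 'rV[R]_m) :
  homeomorphic M (@unit_sphere R) -> surface_with_boundary M.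
Proof.
move=> hM x Mx; have [f [g fgP]] := hM; have [_ _ fMS gSM [gf fg]] := fgP.
pose e : R := if f x 0 2%:R == 1 then -1 else 1.
have e1 : e ^+ 2 = 1 by rewrite /e; case: ifP => _; rewrite ?sqrrN expr1n.
have xe : f x 0 2%:R != e.
  by rewrite /e; case: ifP => [/eqP->|/negbT//]; apply/eqP; lra.
have pole z : unit_sphere z -> z 0 2%:R = e -> z = row3 0 0 e.
  move=> /unit_sphereE + ze; rewrite ze e1 => /eqP.
  rewrite -subr_eq0 addrK paddr_eq0 ?sqr_ge0 // !sqrf_eq0 => /andP[/eqP z0 /eqP z1].
  by apply: row3P; rewrite row3E.
have poleS : unit_sphere (row3 0 0 e).
  by apply/unit_sphereE; rewrite !row3E e1; ring.
have Sf z : M z -> unit_sphere (f z) by move=> Mz; apply: fMS; exists z.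
exists (~` [set g (row3 0 0 e)]); split.
- rewrite openC; apply: accessible_closed_set1.
  exact/hausdorff_accessible/norm_hausdorff.
- by move=> /= xp; move: xe; rewrite xp fg // row3E eqxx.
- left; apply: homeomorphic_trans (stereo_homeomorphic e1).
  apply: homeomorphic_restrict fgP _ _ _ _ => [z []//|z []//||].
    move=> _ [z [Mz zp] <-]; split; first exact: Sf.
    by apply/eqP => /(pole _ (Sf _ Mz)) fz; apply: zp; rewrite -fz gf.
  move=> _ [z [Sz ze] <-]; split; first by apply: gSM; exists z.
  by move=> /= /(congr1 f); rewrite !fg // => zE; move: ze; rewrite /= zE row3E eqxx.
Qed.

(** * Piecewise linear maps and rigid triangles *)

Section PLMap.
Context {R : realType} {m n : nat}.
Implicit Types (p : 'I_m -> 'rV[R]_n) (x y : 'rV[R]_m) (s : {set 'I_m}).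

Definition plmap p x : 'rV[R]_n := \sum_i x 0 i *: p i.

Lemma plmap_vertex p i : plmap p (vertex i) = p i.
Proof.
rewrite /plmap (bigD1 i) //= mxE !eqxx scale1r big1 ?addr0 // => j ji.
by rewrite mxE /= (negPf ji) scale0r.
Qed.

Lemma plmap_continuous p : continuous (plmap p).
Proof.
move=> x; apply: continuous_at_sum => i; apply: for_continuousZ.
  exact: coord_continuous.
exact: for_continuous_cst.
Qed.

Lemma dot_plmap p (h : 'rV[R]_n) x :
  dot h (plmap p x) = \sum_i x 0 i * dot h (p i).
Proof. by rewrite dotC dot_suml; apply: eq_bigr => i _; rewrite dotZl dotC. Qed.

Lemma simplex_vertex s i : i \in s -> simplex s (@vertex R m i).
Proof.
move=> si; split=> [j|| j sj].
- by rewrite mxE ler0n.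
- rewrite (bigD1 i) //= mxE !eqxx big1 ?addr0 // => j ji.
  by rewrite mxE /= (negPf ji).
- by rewrite mxE /=; case: eqVneq => // ji; rewrite ji si in sj.
Qed.

Lemma plmap_simplexE p x (a b c : 'I_m) :
  uniq [:: a; b; c] -> simplex [set a; b; c]%SET x ->
  [/\ x 0 a = 1 - x 0 b - x 0 c, 
      plmap p x = p a + x 0 b *: (p b - p a) + x 0 c *: (p c - p a) &
      forall i, i \notin [set a; b; c]%SET -> x 0 i = 0].
Proof.
rewrite /= !inE negb_or => /and3P[/andP[ab ac] bc _] [_ sum1 out].
have out' i : i != a -> i != b -> i != c -> x 0 i = 0.
  by move=> ia ib ic; apply: out; rewrite !inE !negb_or ia ib ic.
have xa : x 0 a = 1 - x 0 b - x 0 c.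
  rewrite -sum1 (bigD1 a) //= (bigD1 b) 1?eq_sym //= (bigD1 c) /=; last first.
    by rewrite eq_sym ac eq_sym bc.
  rewrite big1 => [|i /andP[/andP[ia ib] ic]]; first by ring.
  exact: out'.
split=> //; rewrite /plmap (bigD1 a) //= (bigD1 b) 1?eq_sym //= (bigD1 c) /=; last first.
  by rewrite eq_sym ac eq_sym bc.
rewrite big1 => [|i /andP[/andP[ia ib] ic]]; last by rewrite out' ?scale0r.
apply/rowP => i; rewrite !mxE xa; ring.
Qed.

End PLMap.

Section Nondegenerate.
Context {R : realType}.

(** Gram determinant: the squared area of the parallelogram on u and v. *)
Definition gram (n : nat) (u v : 'rV[R]_n) : R :=
  dot u u * dot v v - dot u v ^+ 2.

Lemma gram_free n (u v : 'rV[R]_n) (s t : R) :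
  gram u v != 0 -> s *: u + t *: v = 0 -> s = 0 /\ t = 0.
Proof.
move=> g0 e.
have eu : s * dot u u + t * dot u v = 0.
  by rewrite -(dot0l u) -e dotDl !dotZl (dotC v).
have ev : s * dot u v + t * dot v v = 0.
  by rewrite -(dot0l v) -e dotDl !dotZl.
split; apply: (mulIf g0); rewrite mul0r /gram.
  transitivity (dot v v * (s * dot u u + t * dot u v)
    - dot u v * (s * dot u v + t * dot v v)); first by ring.
  by rewrite eu ev; ring.
transitivity (dot u u * (s * dot u v + t * dot v v)
  - dot u v * (s * dot u u + t * dot u v)); first by ring.
by rewrite eu ev; ring.
Qed.

Lemma gram_gt0 n (u v : 'rV[R]_n) : gram u v != 0 -> 0 < dot u u.
Proof.
rewrite dot_gt0; apply: contraNneq => ->.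
by rewrite /gram !dot0l mul0r expr0n subrr.
Qed.

Definition nondegenerate m n (p : 'I_m -> 'rV[R]_n) (s : {set 'I_m}) : Prop :=
  exists a b c, [/\ s = [set a; b; c]%SET, uniq [:: a; b; c] &
                    gram (p b - p a) (p c - p a) != 0].

Lemma nondegenerate_inj m n (p : 'I_m -> 'rV[R]_n) s x y :
  nondegenerate p s -> simplex s x -> simplex s y ->
  plmap p x = plmap p y -> x = y.
Proof.
move=> [a [b [c [-> uabc g0]]]] sx sy e.
have [xa pxE x0] := plmap_simplexE p uabc sx.
have [ya pyE y0] := plmap_simplexE p uabc sy.
have [/eqP] : x 0 b - y 0 b = 0 /\ x 0 c - y 0 c = 0.
  apply: (gram_free g0); have := subrr (plmap p y); rewrite -{1}e pxE pyE => <-.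
  by apply/rowP => i; rewrite !mxE; ring.
rewrite subr_eq0 => /eqP eb /eqP; rewrite subr_eq0 => /eqP ec.
apply/rowP => i; have [|ni] := boolP (i \in [set a; b; c]%SET); last by rewrite x0 ?y0.
rewrite !inE => /orP[/orP[]|] /eqP-> //.
by rewrite xa ya eb ec.
Qed.

(** Coordinates with respect to an orthonormal basis of the plane of the
    triangle, obtained from its sides u and v by the Gram-Schmidt process,
    provide a congruent triangle of the plane. *)
Lemma planar_triangle m n (p : 'I_m -> 'rV[R]_n) (s : {set 'I_m}) :
  nondegenerate p s ->
  exists D : 'M[R]_(m, 2), forall x y, simplex s x -> simplex s y ->
    dot (x *m D - y *m D) (x *m D - y *m D) =
    sqdist (plmap p x) (plmap p y).
Proof.
move=> [a [b [c [-> uabc g0]]]].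
set u := p b - p a in g0; set v := p c - p a in g0.
have uu := gram_gt0 g0.
pose w := v - (dot u v / dot u u) *: u.
have uw : dot u w = 0.
  by rewrite /w dotBr dotZr divfK ?gt_eqF // subrr.
have vw : dot v w = dot w w.
  by rewrite {2}/w [RHS]dotBl [dot (_ *: _) _]dotZl uw mulr0 subr0.
have ww : 0 < dot w w.
  rewrite dot_gt0; apply: contraNneq g0 => w0.
  have : dot w w * dot u u = gram u v.
    by rewrite -vw /w dotBr dotZr (dotC v u) /gram; field; rewrite gt_eqF.
  by rewrite w0 dot0l mul0r => <-.
pose D : 'M[R]_(m, 2) := \matrix_(i, j)
  dot (p i) (if j == 0 then (enorm u)^-1 *: u else (enorm w)^-1 *: w).
have mulD z j : (z *m D) 0 j = dot (plmap p z)
    (if j == 0 then (enorm u)^-1 *: u else (enorm w)^-1 *: w).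
  by rewrite mxE dot_suml; apply: eq_bigr => i _; rewrite [D _ _]mxE dotZl.
exists D => x y sx sy.
have [_ pxE _] := plmap_simplexE p uabc sx.
have [_ pyE _] := plmap_simplexE p uabc sy.
rewrite /sqdist dot2E -!mulmxBl !mulD /=.
have -> : plmap p (x - y) = plmap p x - plmap p y.
  rewrite /plmap -sumrB; apply: eq_bigr => i _.
  by rewrite -scalerBl !mxE.
set z := plmap p x - plmap p y.
have zE : z = (x 0 b - y 0 b + (x 0 c - y 0 c) * (dot u v / dot u u)) *: u
    + (x 0 c - y 0 c) *: w.
  by rewrite /z pxE pyE /w -/u -/v; apply/rowP => i; rewrite !mxE; ring.
move: zE; set t := x 0 c - y 0 c; set r := x 0 b - y 0 b + _ => zE.
have zu : dot z u = r * dot u u by rewrite zE dotDl !dotZl (dotC w) uw mulr0 addr0.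
have zw : dot z w = t * dot w w by rewrite zE dotDl !dotZl uw mulr0 add0r.
have -> : dot z z = r ^+ 2 * dot u u + t ^+ 2 * dot w w.
  by rewrite {1}zE dotDl !dotZl (dotC u) (dotC w) zu zw; ring.
rewrite !dotZr zu zw -!expr2 -!sqr_enorm.
have eu : enorm u != 0 by rewrite gt_eqF // enorm_gt0 -dot_gt0.
have ew : enorm w != 0 by rewrite gt_eqF // enorm_gt0 -dot_gt0.
by field; rewrite eu ew.
Qed.

End Nondegenerate.

Section Polyhedron.
Context {R : realType} {m : nat}.
Implicit Types (p q : 'I_m -> 'rV[R]_3) (K : {set {set 'I_m}}).

Lemma plmap_linear_on s p : linear_on s (plmap p).
Proof. by move=> x _; apply: eq_bigr => i _; rewrite plmap_vertex. Qed.

Lemma plmap_polyhedron K p :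
  surface_with_boundary (@realization R m K) ->
  (forall s, s \in K -> nondegenerate p s) -> polyhedron K (plmap p).
Proof.
move=> surf nd.
have [D DP] : {D : {set 'I_m} -> 'M[R]_(m, 2) & forall s, s \in K ->
    forall x y, simplex s x -> simplex s y ->
    dot (x *m D s - y *m D s) (x *m D s - y *m D s) =
    sqdist (plmap p x) (plmap p y)}.
  apply: (@choice _ _ (fun s D => s \in K -> forall x y, simplex s x -> simplex s y ->
    dot (x *m D - y *m D) (x *m D - y *m D) = sqdist (plmap p x) (plmap p y))) => s.
  have [/nd/planar_triangle[D DP]|sK] := boolP (s \in K); first by exists D.
  by exists 0.
have edistD s x y : s \in K -> simplex s x -> simplex s y ->
    edist (plmap p x) (plmap p y) = edist (x *m D s) (y *m D s).
  by move=> sK sx sy; apply/edist_eq; rewrite DP.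
exists D; split=> //.
- split=> [s /nd[a [b [c [-> uabc _]]]]|s x y sK sx sy e|s s' v w sK s'K vs ws vs' ws'].
  + by move: uabc; rewrite /= !inE andbT negb_or -finset.setUA !cardsU1 cards1 !inE negb_or => /andP[-> ->].
  + apply: (nondegenerate_inj (nd _ sK) sx sy); apply/eqP.
    by rewrite -subr_eq0 -dot_eq0 -/(sqdist _ _) -(DP s) // e subrr dot0l.
  + by rewrite !rowE -!edistD //; exact: simplex_vertex.
- by apply: continuous_subspaceT => x; exact: plmap_continuous.
- by move=> s sK; split=> [|x y sx sy]; [exact: plmap_linear_on|exact: edistD].
Qed.

Definition cross (u v : 'rV[R]_3) : 'rV[R]_3 :=
  row3 (u 0 1 * v 0 2%:R - u 0 2%:R * v 0 1)
       (u 0 2%:R * v 0 0 - u 0 0 * v 0 2%:R)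
       (u 0 0 * v 0 1 - u 0 1 * v 0 0).

(** The isometry is the affine map that also carries the cross product of the
    sides to the cross product of the sides. The linear part T writes x in the
    basis u, v, cross u v by means of the dual basis; it preserves lengths because
    the Gram matrices of the two bases agree. *)
Lemma isometry_triangle (a u v a' u' v' : 'rV[R]_3) : gram u v != 0 ->
  dot u u = dot u' u' -> dot u v = dot u' v' -> dot v v = dot v' v' ->
  exists2 g, isometry g & forall s t : R,
    g (a + s *: u + t *: v) = a' + s *: u' + t *: v'.
Proof.
move=> g0 euu euv evv.
pose T (x : 'rV[R]_3) : 'rV[R]_3 :=
  ((dot x u * dot v v - dot x v * dot u v) / gram u v) *: u' +
  ((dot x v * dot u u - dot x u * dot u v) / gram u v) *: v' +
  (dot x (cross u v) / gram u v) *: cross u' v'.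
have TB x y : T (x - y) = T x - T y.
  by apply/rowP => i; rewrite !mxE !dotBl; field.
have cross_orth (x y : 'rV[R]_3) : (dot x (cross x y) = 0) * (dot y (cross x y) = 0).
  by split; rewrite dot3E !row3E; ring.
have crossE (x y : 'rV[R]_3) : dot (cross x y) (cross x y) = gram x y.
  by rewrite /gram !dot3E !row3E; ring.
have Tiso x : dot (T x) (T x) = dot x x.
  have e : dot x x * gram u v = dot x u ^+ 2 * dot v v - 2 * dot x u * dot x v * dot u v
      + dot x v ^+ 2 * dot u u + dot x (cross u v) ^+ 2.
    by rewrite /gram !dot3E !row3E; ring.
  apply: (mulIf g0); rewrite e.
  have gE : gram u' v' = gram u v by rewrite /gram euu euv evv.
  have := cross_orth u' v'; move: (crossE u' v') (dotC (cross u' v')).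
  rewrite gE /T; set n' := cross u' v'; set X := dot x u; set Y := dot x v.
  set Z := dot x _ => nn dC [un vn].
  rewrite !(dotDl, dotDr, dotZl, dotZr) !dC un vn nn (dotC v') -euu -euv -evv.
  by move: g0; rewrite /gram => g0; field.
exists (fun x => a' + T (x - a)) => [x y|s t].
  apply/edist_eq; have -> : a' + T (x - a) - (a' + T (y - a)) = T (x - y).
    have -> : x - y = (x - a) - (y - a) by apply/rowP => i; rewrite !mxE; ring.
    by rewrite [in RHS]TB opprD addrACA subrr add0r.
  exact: Tiso.
have -> : a + s *: u + t *: v - a = s *: u + t *: v by apply/rowP => i; rewrite !mxE; ring.
rewrite -addrA; congr (_ + _); rewrite /T !dotDl !dotZl !cross_orth (dotC v u).
apply/rowP => i; rewrite !mxE; move: g0; rewrite /gram => g0; field; exact: g0.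
Qed.

(** The criterion side-side-side. *)
Lemma plmap_faces_congruent K p q :
  (forall s, s \in K -> nondegenerate p s) ->
  (forall s v w, s \in K -> v \in s -> w \in s ->
     sqdist (p v) (p w) = sqdist (q v) (q w)) ->
  corresponding_faces_congruent K (plmap p) (plmap q).
Proof.
move=> nd epq s sK; have [a [b [c [sE uabc g0]]]] := nd _ sK.
have inS : [/\ a \in s, b \in s & c \in s] by rewrite sE !inE !eqxx !orbT.
have [aS bS cS] := inS.
have ab := epq _ _ _ sK bS aS; have ac := epq _ _ _ sK cS aS; have bc := epq _ _ _ sK bS cS.
have eb : dot (p b - p a) (p c - p a) = dot (q b - q a) (q c - q a).
  by rewrite !polarization ab ac bc.
have [g giso gE] := isometry_triangle (p a) (q a) g0 ab eb ac.
exists g => // x; rewrite sE => sx.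
have [_ -> _] := plmap_simplexE p uabc sx.
by have [_ -> _] := plmap_simplexE q uabc sx.
Qed.

End Polyhedron.

(** * Dihedral angles *)

Section Dihedral.
Context {R : realType}.
Implicit Types (u v a b : 'rV[R]_3).

Lemma angle_inj u v a b : u != 0 -> v != 0 -> 
  dot u u = dot a a -> dot v v = dot b b -> angle u v = angle a b ->
  dot u v = dot a b.
Proof.
move=> u0 v0 ua vb.
have nz : enorm u * enorm v != 0 by rewrite mulf_neq0 // gt_eqF // enorm_gt0.
have bound (x y : 'rV[R]_3) : x != 0 -> y != 0 ->
    dot x y / (enorm x * enorm y) \in `[(-1), 1].
  move=> x0 y0; have xy : 0 < enorm x * enorm y by rewrite mulr_gt0 ?enorm_gt0.
  rewrite in_itv /= ler_pdivlMr // ler_pdivrMr // mulN1r mul1r dot_le_enorm.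
  by rewrite lerNl -dotNl (le_trans (dot_le_enorm _ _)) // /enorm dotNl dotNr opprK.
rewrite /angle => /(congr1 (@cos R)); rewrite !acosK ?bound -?dot_gt0 -?ua -?vb ?dot_gt0 //.
by rewrite /enorm -ua -vb -!/(enorm _) => /(mulIf _) ->//; rewrite invr_neq0.
Qed.

Lemma dot_normal_part u a b : u != 0 ->
  dot (normal_part u a) (normal_part u b) = dot a b - dot a u * dot b u / dot u u.
Proof.
rewrite -dot_gt0 => uu; rewrite /normal_part !(dotBl, dotBr, dotZl, dotZr) (dotC u b).
by field; rewrite gt_eqF.
Qed.

Lemma normal_part_neq0 u a : gram u a != 0 -> normal_part u a != 0.
Proof.
move=> g0; have uu := gram_gt0 g0; rewrite -dot_gt0 lt_def dot_ge0 andbT.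
rewrite dot_normal_part -?dot_gt0 // (_ : _ - _ = gram u a / dot u u).
  by rewrite mulf_neq0 // invr_neq0 // gt_eqF.
by rewrite /gram (dotC a u); field; rewrite gt_eqF.
Qed.

(** Let all five sides of the two triangles at the edge vw keep their lengths.
    Then the components of a - v and b - v along the edge and the lengths of
    their orthogonal components are kept, so that the dihedral angle determines
    dot (a - v) (b - v), hence the distance from a to b. *)
Lemma dihedral_angle_distance m (p q : 'I_m -> 'rV[R]_3) (v w a b : 'I_m) :
  gram (p w - p v) (p a - p v) != 0 -> gram (p w - p v) (p b - p v) != 0 ->
  sqdist (p v) (p w) = sqdist (q v) (q w) ->
  sqdist (p v) (p a) = sqdist (q v) (q a) ->
  sqdist (p w) (p a) = sqdist (q w) (q a) ->
  sqdist (p v) (p b) = sqdist (q v) (q b) ->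
  sqdist (p w) (p b) = sqdist (q w) (q b) ->
  dihedral_angle (plmap p) v w a b = dihedral_angle (plmap q) v w a b ->
  sqdist (p a) (p b) = sqdist (q a) (q b).
Proof.
move=> ga gb vw va wa vb wb; rewrite /dihedral_angle !plmap_vertex.
have uu : p w - p v != 0 by rewrite -dot_gt0 (gram_gt0 ga).
have polar (f : 'I_m -> 'rV[R]_3) (i j : 'I_m) : dot (f i - f v) (f j - f v) =
    (sqdist (f v) (f i) + sqdist (f v) (f j) - sqdist (f j) (f i)) / 2.
  by rewrite polarization (sqdistC (f i) (f v)) (sqdistC (f j) (f v)) (sqdistC (f i)).
have sq0 (f : 'I_m -> 'rV[R]_3) (i : 'I_m) : sqdist (f i) (f i) = 0.
  by rewrite /sqdist subrr dot0l.
have euu : dot (p w - p v) (p w - p v) = dot (q w - q v) (q w - q v).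
  by rewrite !polar !sq0 vw.
have uu' : q w - q v != 0 by rewrite -dot_gt0 -euu dot_gt0.
have ea : dot (p a - p v) (p w - p v) = dot (q a - q v) (q w - q v).
  by rewrite !polar va vw wa.
have eb : dot (p b - p v) (p w - p v) = dot (q b - q v) (q w - q v).
  by rewrite !polar vb vw wb.
have eaa : dot (p a - p v) (p a - p v) = dot (q a - q v) (q a - q v).
  by rewrite !polar !sq0 va.
have ebb : dot (p b - p v) (p b - p v) = dot (q b - q v) (q b - q v).
  by rewrite !polar !sq0 vb.
move/(angle_inj (normal_part_neq0 ga) (normal_part_neq0 gb)).
rewrite !dot_normal_part // eaa ebb ea eb euu => /(_ erefl erefl) /addIr.
rewrite (dotC (p a - p v)) (dotC (q a - q v)) !polar va vb => e; lra.
Qed.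

End Dihedral.

(** * Spheres from convex polyhedra *)

Section Compactness.
Context {R : realType} {m : nat}.

Lemma simplex_closed (s : {set 'I_m}) : closed (@simplex R m s).
Proof.
have coord_closed i (A : set R) : closed A -> closed [set x : 'rV[R]_m | A (x 0 i)].
  by move=> clA; apply: (@preimage_closed _ _ (fun x : 'rV[R]_m => x 0 i)) => // x _;
    exact: coord_continuous.
have -> : @simplex R m s =
    \bigcap_i [set x : 'rV[R]_m | 0 <= x 0 i] `&`
    [set x | \sum_i x 0 i = 1] `&`
    \bigcap_(i in [set i | i \notin s]) [set x | x 0 i = 0].
  apply/seteqP; split=> x.
    by move=> [x0 x1 xs]; split; [split=> // i _; exact: x0|exact: xs].
  by move=> [[x0 x1] xs]; split=> // i; exact: x0.
apply: closedI; first apply: closedI.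
- by apply: closed_bigI => i _; exact: (coord_closed i [set y | 0 <= y] (@closed_ge _ 0)).
- apply: (@preimage_closed _ _ (fun x : 'rV[R]_m => \sum_i x 0 i) [set 1]); last exact: closed_eq.
  by move=> x _; apply: continuous_at_sum => i; exact: coord_continuous.
- by apply: closed_bigI => i _; exact: (coord_closed i [set 0] (@closed_eq _ 0)).
Qed.

Lemma realization_compact (K : {set {set 'I_m}}) : compact (@realization R m K).
Proof.
apply: bounded_closed_compact.
  exists 1; split; first exact: num_real.
  move=> M M1 x [s _ [x0 x1 _]]; apply: ltW; apply: le_lt_trans M1.
  rewrite /Num.Def.normr /= mx_normrE bigmax_le // => -[i j] _ /=.
  rewrite (ord1 i) ger0_norm // -x1 (bigD1 j) //= lerDl.
  by apply: sumr_ge0 => k _; exact: x0.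
have -> : @realization R m K = \bigcup_(s in [set` K]) simplex s.
  by apply/seteqP; split=> x [s sK sx]; exists s.
apply: closed_bigcup => [|s _]; [exact: finite_finset|exact: simplex_closed].
Qed.

End Compactness.

(** The points q i are the vertices of a convex polytope around the origin whose
    facets are spanned by the members s of K; the supporting plane of the facet s
    is dot (n s) = 1. Radial projection identifies its boundary with the
    sphere. *)
Section ConvexSphere.
Context {R : realType} {m : nat}.
Variables (K : {set {set 'I_m}}) (q : 'I_m -> 'rV[R]_3).
Variables (n : {set 'I_m} -> 'rV[R]_3) (s0 : {set 'I_m}).
Hypothesis s0K : s0 \in K.
Hypothesis n_le1 : forall s i, s \in K -> dot (n s) (q i) <= 1.
Hypothesis n_eq1 : forall s i, s \in K -> (dot (n s) (q i) == 1) = (i \in s).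
Hypothesis span : forall s (y : 'rV[R]_3), s \in K ->
  exists2 c : 'rV[R]_m, (forall i, i \notin s -> c 0 i = 0) & y = plmap q c.
Hypothesis neighbour : forall s i, s \in K -> i \in s ->
  exists2 s', s' \in K & i \notin s' /\ forall j, j \in s -> j != i -> j \in s'.

Let n_face s i : s \in K -> i \in s -> dot (n s) (q i) = 1.
Proof. by move=> sK si; apply/eqP; rewrite n_eq1. Qed.

(** Across a side of s, the functionals n s and n s' agree on the two common
    vertices, so that their difference reads off the coefficient of the third
    vertex i. *)
Let coeff s s' (c : 'rV[R]_m) i : s \in K -> s' \in K -> i \notin s' ->
  (forall j, j \in s -> j != i -> j \in s') ->
  (forall j, j \notin s -> c 0 j = 0) ->
  dot (n s - n s') (plmap q c) = c 0 i * (dot (n s) (q i) - dot (n s') (q i)).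
Proof.
move=> sK s'K is' ss' cs; rewrite dot_plmap (bigD1 i) //= big1 => [|j ji].
  by rewrite addr0 dotBl.
have [js|js] := boolP (j \in s); last by rewrite cs // mul0r.
by rewrite dotBl !n_face ?ss' // subrr mulr0.
Qed.

Let facet_value s x : s \in K -> simplex s x -> dot (n s) (plmap q x) = 1.
Proof.
move=> sK [_ <- xs]; rewrite dot_plmap; apply: eq_bigr => i _.
have [js|js] := boolP (i \in s); last by rewrite xs // mul0r.
by rewrite n_face // mulr1.
Qed.

Let facet_le s s' x : s \in K -> simplex s' x -> dot (n s) (plmap q x) <= 1.
Proof.
move=> sK [x0 <- _]; rewrite dot_plmap; apply: ler_sum => i _.
by rewrite ler_piMr // n_le1.
Qed.

Let facet_eq s s' x : s \in K -> simplex s' x ->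
  dot (n s) (plmap q x) = 1 -> simplex s x.
Proof.
move=> sK [x0 x1 xs'] e; split=> // i si.
have : \sum_j x 0 j * (1 - dot (n s) (q j)) = 0.
  under eq_bigr do rewrite mulrBr mulr1.
  by rewrite sumrB -dot_plmap e x1 subrr.
move/eqP; rewrite psumr_eq0 => [/allP/(_ i)|j _]; last first.
  by rewrite mulr_ge0 // subr_ge0 n_le1.
rewrite mem_index_enum /= mulf_eq0 subr_eq0 (eq_sym 1) n_eq1 // (negPf si) orbF.
by move=> /(_ isT)/eqP.
Qed.

Let simplex_inj s x y : s \in K -> simplex s x -> simplex s y ->
  plmap q x = plmap q y -> x = y.
Proof.
move=> sK [_ _ xs] [_ _ ys] e; apply/rowP => i.
have [si|si] := boolP (i \in s); last by rewrite xs // ys.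
have [s' s'K [is' ss']] := neighbour sK si.
have := coeff sK s'K is' ss' xs; rewrite e (coeff sK s'K is' ss' ys) => /mulIf -> //.
by rewrite subr_eq0 n_face // eq_sym n_eq1.
Qed.

Let radial (x : 'rV[R]_m) : 'rV[R]_3 := (enorm (plmap q x))^-1 *: plmap q x.

(** Injectivity: two boundary points on a ray both have maximal facet value 1,
    hence coincide. Surjectivity: a direction y lies in the cone over the facet s
    that maximizes dot (n s) y. Indeed its coefficient at a vertex i of s is
    nonnegative by [coeff], applied to the neighbour of s across the side
    opposite to i, on which the functional is not larger. *)
Lemma convex_sphere : homeomorphic (@realization R m K) (@unit_sphere R).
Proof.
have pl0 x : @realization R m K x -> plmap q x != 0.
  move=> [s sK sx]; apply: contraTneq (oner_neq0 R) => p0.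
  by rewrite -(facet_value sK sx) p0 dotC dot0l eqxx.
have radialS x : @realization R m K x -> unit_sphere (radial x).
  move=> /pl0 p0; rewrite /unit_sphere /= /radial enormZ ger0_norm ?invr_ge0 ?enorm_ge0 //.
  by rewrite mulVf // gt_eqF // enorm_gt0.
suff <- : radial @` @realization R m K = @unit_sphere R.
  apply: compact_inj_homeomorphic.
  - exact: 0.
  - exact: norm_hausdorff.
  - exact: realization_compact.
  - apply: continuous_in_subspaceT => x; rewrite inE => /pl0 p0.
    have cpl := @plmap_continuous R m 3 q x.
    apply: for_continuousZ; last exact: cpl.
    apply: for_continuousV; first by rewrite gt_eqF // enorm_gt0.
    apply: for_continuous_sqrt; rewrite /dot.
    apply: continuous_at_sum => i.
    by apply: for_continuousM; apply: for_continuous_coord.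
  - move=> x y [s sK sx] [s' s'K sy] exy.
    have xp : 0 < enorm (plmap q x) by rewrite enorm_gt0 pl0 //; exists s.
    have yp : 0 < enorm (plmap q y) by rewrite enorm_gt0 pl0 //; exists s'.
    pose l := enorm (plmap q x) / enorm (plmap q y).
    have l0 : 0 < l by rewrite divr_gt0.
    have exl : plmap q x = l *: plmap q y.
      by rewrite /l -scalerA -/(radial y) -exy scalerA divff ?scale1r // gt_eqF.
    have le1 : 1 <= l.
      rewrite -[leLHS](facet_value sK sx) exl dotC dotZl dotC ler_piMr ?(ltW l0) //.
      exact: facet_le sy.
    have ge1 : l <= 1.
      by have := facet_le s'K sx; rewrite exl dotC dotZl dotC (facet_value s'K sy) mulr1.
    have l1 : l = 1 by apply/eqP; rewrite eq_le le1 ge1.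
    rewrite l1 scale1r in exl; apply: (simplex_inj sK) => //.
    by apply: facet_eq sy _ => //; rewrite -exl facet_value.
apply/seteqP; split=> [_ [x Kx <-]|y Sy]; first exact: radialS.
have y0 : y != 0.
  by rewrite -enorm_gt0 Sy ltr01.
pose s := [arg max_(s > s0 in K) dot (n s) y]%O.
have [sK smax] : s \in K /\ forall s', s' \in K -> dot (n s') y <= dot (n s) y.
  by rewrite /s; case: arg_maxP.
have [c cs yE] := span y sK.
have c0 i : 0 <= c 0 i.
  have [si|si] := boolP (i \in s); last by rewrite cs.
  have [s' s'K [is' ss']] := neighbour sK si.
  have := smax _ s'K; rewrite -subr_ge0 -dotBl yE (coeff sK s'K is' ss' cs).
  rewrite n_face // pmulr_lge0 // subr_gt0.
  by rewrite lt_neqAle n_le1 // n_eq1 // is'.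
pose T := \sum_i c 0 i.
have T0 : 0 < T.
  rewrite lt_def sumr_ge0 // andbT; apply: contra y0 => /eqP /psumr_eq0P c00.
  rewrite yE; apply/eqP; apply: big1 => i _; rewrite c00 ?scale0r //.
exists (T^-1 *: c).
  exists s => //; split=> [i||i si].
  - by rewrite mxE mulr_ge0 // invr_ge0 ltW.
  - under eq_bigr do rewrite mxE.
    by rewrite -mulr_sumr mulVf // gt_eqF.
  - by rewrite mxE cs // mulr0.
have plE : plmap q (T^-1 *: c) = T^-1 *: y.
  rewrite yE /plmap scaler_sumr; apply: eq_bigr => i _.
  by rewrite mxE scalerA.
rewrite /radial plE enormZ Sy mulr1 ger0_norm ?invr_ge0 ?ltW // invrK scalerA.
by rewrite mulfV ?scale1r // gt_eqF.
Qed.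

End ConvexSphere.

(** * Separated triangles and integer coordinates *)

Section Separation.
Context {R : realType} {m : nat}.
Implicit Types (p : 'I_m -> 'rV[R]_3) (K : {set {set 'I_m}}).

(** Contact with the plane dot h = d is allowed only at vertices common to s and
    s', which covers triangles that share a vertex or a side. *)
Definition separated p (s s' : {set 'I_m}) : Prop :=
  exists (h : 'rV[R]_3) (d : R), [/\ forall i, i \in s -> d <= dot h (p i),
    forall i, i \in s' -> dot h (p i) <= d &
    forall i, i \in s -> dot h (p i) = d -> i \in s'].

(** A common point lies in the plane, so its coordinates vanish at the vertices
    of s outside the plane, hence at those outside s'. Both x and y are therefore
    in the simplex of s', where the map is injective. *)
Lemma separated_inj p s s' x y : separated p s s' -> nondegenerate p s' ->
  simplex s x -> simplex s' y -> plmap p x = plmap p y -> x = y.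
Proof.
move=> [h [d [sd s'd sin]]] nd sx sy e.
apply: (nondegenerate_inj nd) => //; have [x0 x1 xs] := sx; have [y0 y1 ys] := sy.
split=> // i is'; have [si|/xs//] := boolP (i \in s).
have xi j : 0 <= x 0 j * (dot h (p j) - d).
  have [/sd|/xs ->] := boolP (j \in s); last by rewrite mul0r.
  by rewrite -subr_ge0 => ?; rewrite mulr_ge0.
have : \sum_j x 0 j * (dot h (p j) - d) <= 0.
  under eq_bigr do rewrite mulrBr.
  rewrite sumrB -dot_plmap e dot_plmap -mulr_suml x1 mul1r subr_le0.
  rewrite -[leRHS]mul1r -y1 mulr_suml; apply: ler_sum => j _.
  have [/s'd|/ys ->] := boolP (j \in s'); last by rewrite !mul0r.
  by move=> ?; rewrite ler_wpM2l.
rewrite le_eqVlt ltNge sumr_ge0 // orbF psumr_eq0 // => /allP/(_ i).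
rewrite mem_index_enum mulf_eq0 subr_eq0 => /(_ isT) /orP[/eqP//|/eqP/sin].
by rewrite (negPf is') => /(_ si).
Qed.

Lemma plmap_no_self_intersections K p :
  (forall s, s \in K -> nondegenerate p s) ->
  (forall s s', s \in K -> s' \in K -> separated p s s' \/ separated p s' s) ->
  no_self_intersections K (plmap p).
Proof.
move=> nd sep x y [s sK sx] [s' s'K sy] e; have [|] := sep _ _ sK s'K => ss.
  exact: separated_inj ss (nd _ s'K) sx sy e.
by apply/esym; apply: separated_inj ss (nd _ sK) sy sx (esym e).
Qed.

End Separation.

Section Triangles.
Variable m : nat.
Local Notation tri := (nat * nat * nat)%type.

Definition corners (t : tri) : seq nat := [:: t.1.1; t.1.2; t.2].

Definition triangle (t : tri) : {set 'I_m} :=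
  [set i : 'I_m | (i : nat) \in corners t].

Lemma in_triangle t (i : 'I_m) : (i \in triangle t) = ((i : nat) \in corners t).
Proof. by rewrite inE. Qed.

Definition complex (T : seq tri) : {set {set 'I_m}} :=
  [set s in map triangle T].

Lemma complexP T s :
  reflect (exists2 t, t \in T & s = triangle t) (s \in complex T).
Proof. by rewrite inE; exact: mapP. Qed.

Definition wf_tri (t : tri) : bool :=
  uniq (corners t) && all (fun i => (i < m)%N) (corners t).

End Triangles.

Section Wf.
Variables (m : nat).

Lemma triangleE (t : nat * nat * nat) : wf_tri m.+1 t ->
  triangle m.+1 t = [set inord t.1.1; inord t.1.2; inord t.2]%SET /\
  uniq [:: inord t.1.1 : 'I_m.+1; inord t.1.2; inord t.2].
Proof.
case: t => -[a b] c; rewrite /wf_tri [all _ _]/= => /andP[u] /and4P[am bm cm _].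
have inj i : (i < m.+1)%N -> val (inord i : 'I_m.+1) = i by exact: inordK.
split; last by rewrite -(map_inj_uniq val_inj) /= !inordK.
by apply/setP => i; rewrite !inE /corners /= -!val_eqE /= !inordK // orbA.
Qed.

End Wf.

Section IntegerVectors.
Local Open Scope Z_scope.
Definition ivec := (Z * Z * Z)%type.
Implicit Types u v w : ivec.
Definition idot u v := u.1.1 * v.1.1 + u.1.2 * v.1.2 + u.2 * v.2.
Definition isub u v : ivec := (u.1.1 - v.1.1, u.1.2 - v.1.2, u.2 - v.2).
Definition iadd u v : ivec := (u.1.1 + v.1.1, u.1.2 + v.1.2, u.2 + v.2).
Definition iopp u : ivec := (- u.1.1, - u.1.2, - u.2).
Definition icross u v : ivec :=
  (u.1.2 * v.2 - u.2 * v.1.2, u.2 * v.1.1 - u.1.1 * v.2,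
   u.1.1 * v.1.2 - u.1.2 * v.1.1).
Definition igram u v := idot u u * idot v v - idot u v * idot u v.
Definition corner (P : seq ivec) (i : nat) := nth (0, 0, 0) P i.
End IntegerVectors.

(** Locked, so that conversion never expands the large coordinates below into
    unary numbers. *)
HB.lock Definition zreal {R : realType} (z : Z) : R := (int_of_Z z)%:~R.

Section Cast.
Context {R : realType}.
Local Notation zreal := (@zreal R).

Definition rvec (u : ivec) : 'rV[R]_3 := row3 (zreal u.1.1) (zreal u.1.2) (zreal u.2).

Lemma zrealD a b : zreal (Z.add a b) = zreal a + zreal b.
Proof. by rewrite unlock (rmorphD int_of_Z) intrD. Qed.
Lemma zrealM a b : zreal (Z.mul a b) = zreal a * zreal b.
Proof. by rewrite unlock (rmorphM int_of_Z) intrM. Qed.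
Lemma zrealN a : zreal (Z.opp a) = - zreal a.
Proof. by rewrite unlock (rmorphN int_of_Z) intrN. Qed.
Lemma zrealB a b : zreal (Z.sub a b) = zreal a - zreal b.
Proof. by rewrite -[(Z.sub a b)]/(Z.add a (Z.opp b)) zrealD zrealN. Qed.
Lemma zreal_inj : injective zreal.
Proof. by move=> a b; rewrite unlock => /intr_inj/(can_inj int_of_ZK). Qed.
Lemma zreal_le a b : (zreal a <= zreal b) = Z.leb a b.
Proof. by rewrite unlock ler_int; apply/idP/idP; lia. Qed.
Lemma zreal_lt a b : (zreal a < zreal b) = Z.ltb a b.
Proof. by rewrite unlock ltr_int; apply/idP/idP; lia. Qed.
Lemma zreal_eq a b : (zreal a == zreal b) = Z.eqb a b.
Proof. by rewrite (inj_eq zreal_inj); apply/eqP/idP; lia. Qed.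

Lemma rvec_dot u v : dot (rvec u) (rvec v) = zreal (idot u v).
Proof. by rewrite dot3E !row3E !zrealD !zrealM. Qed.
Lemma rvecB u v : rvec u - rvec v = rvec (isub u v).
Proof.
have subE (x y : 'rV[R]_3) i : (x - y) 0 i = x 0 i - y 0 i by rewrite !mxE.
by apply: row3P; rewrite subE !row3E zrealB.
Qed.

End Cast.

Section Data.
Local Open Scope Z_scope.
Local Open Scope nat_scope.

Definition faces : seq (nat * nat * nat) := [::
  (1,2,4); (2,0,5); (2,8,0); (8,3,0); (2,1,7); (1,3,7); (7,8,2); (7,3,8);
  (10,0,3); (4,0,10); (1,9,3); (1,4,9); (3,9,10); (9,4,10); (4,2,12);
  (12,6,4); (2,5,11); (11,5,6); (2,11,12); (12,11,6); (4,6,14); (4,14,0);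
  (13,6,5); (5,0,13); (14,6,13); (0,14,13)].

Local Open Scope Z_scope.

(** The initial position: 57 times the points (-1,1,3), (2,1,-1), (-4,-6,0),
    (3,3,1), (-5,0,-2), (-7,-1,1), (-10,1,-3) for the labels 0 to 6, followed by
    the images of the hinge ends under the four half-turns. The factor 57 clears
    the denominators 3 and 19 of these images. *)
Definition points : seq ivec := [::
  (-57, 57, 171); (114, 57, -57); (-228, -342, 0); (171, 171, 57);
  (-285, 0, -114); (-399, -57, 57); (-570, 57, -171); (38, -266, -38);
  (-228, -171, 0); (-57, -114, 0); (-228, 114, 0); (-279, -51, 21);
  (-273, -102, -186); (-342, 0, 114); (-228, -57, -57)].

(** Vertices of a convex polytope with the same faces; only its combinatorial
    type is related to the embedded polyhedron. *)
Definition convex_points : seq ivec := [::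
  (1,1,4); (3,-1,-1); (0,-4,-1); (4,0,1); (3,4,-2); (-1,-1,1); (-2,1,-1);
  (3,-2,0); (2,-1,2); (4,2,0); (4,2,1); (-1,-2,-1); (-1,1,-2); (-1,1,2);
  (0,2,1)].

(** A separating plane can be moved until it contains a vertex k of t'. *)
Definition sep_by (P : seq ivec) (h : ivec) (t t' : nat * nat * nat) : bool :=
  has (fun k => let d := idot h (corner P k) in
    all (fun j => idot h (corner P j) <=? d) (corners t') &&
    all (fun i => let e := idot h (corner P i) in
      (d <=? e) && ((e =? d) ==> (i \in corners t'))) (corners t))
    (corners t').

Definition sides (P : seq ivec) (t : nat * nat * nat) : seq ivec :=
  let: (a, b, c) := t in
  [:: isub (corner P b) (corner P a); isub (corner P c) (corner P b);
      isub (corner P a) (corner P c)].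

(** The facets of the Minkowski difference of two triangles are parallel to one
    of them or to a side of each, which gives the candidates for normals. *)
Definition axes (P : seq ivec) t t' : seq ivec :=
  let e := sides P t in let e' := sides P t' in
  let ns := icross (nth (0,0,0) e 0) (nth (0,0,0) e 1) ::
    icross (nth (0,0,0) e' 0) (nth (0,0,0) e' 1) ::
    [seq icross u v | u <- e, v <- e'] in
  ns ++ map iopp ns.

Definition separable P t t' : bool := has (fun h => sep_by P h t t') (axes P t t').

End Data.

(** * The combinatorial sphere and its embedding *)

Section Realize.
Context {R : realType}.
Local Notation tri := (nat * nat * nat)%type.

Definition double_steffen := complex 15 faces.

Definition place (P : seq ivec) (i : 'I_15) : 'rV[R]_3 := rvec (corner P i).

Lemma faces_wf : all (wf_tri 15) faces.
Proof. by vm_compute. Qed.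

Lemma sep_byP P h t t' : all (fun i => (i < 15)%N) (corners t') -> sep_by P h t t' ->
  separated (place P) (triangle 15 t) (triangle 15 t').
Proof.
move=> lt15 /hasP[k kt' /andP[/allP le_d /allP ge_d]].
exists (rvec h), (zreal (idot h (corner P k))); split=> i; rewrite inE => it.
- by rewrite rvec_dot zreal_le; have /andP[] := ge_d _ it.
- by rewrite rvec_dot zreal_le; exact: le_d.
- rewrite rvec_dot inE => /eqP; rewrite zreal_eq => e.
  by have /andP[_ /implyP] := ge_d _ it; apply.
Qed.

Definition pairwise_separable P := all (fun t => all (fun t' =>
  separable P t t' || separable P t' t) faces) faces.

Lemma separableP P t t' : t' \in faces -> separable P t t' ->
  separated (place P) (triangle 15 t) (triangle 15 t').
Proof.
move=> t'F /hasP[h _]; apply: sep_byP.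
by have /allP/(_ _ t'F)/andP[] := faces_wf.
Qed.

Lemma faces_separated P : pairwise_separable P ->
  forall s s', s \in double_steffen -> s' \in double_steffen ->
  separated (place P) s s' \/ separated (place P) s' s.
Proof.
move=> /allP sep s s' /complexP[t tF ->] /complexP[t' t'F ->].
by have /allP/(_ _ t'F)/orP[] := sep _ tF => /separableP; [left|right]; auto.
Qed.

Lemma zreal0 : zreal 0 = 0 :> R. Proof. by rewrite unlock. Qed.

Definition tri_gram (P : seq ivec) (t : tri) : Z :=
  igram (isub (corner P t.1.2) (corner P t.1.1)) (isub (corner P t.2) (corner P t.1.1)).

Lemma rvec_gram u v : gram (rvec u) (rvec v) = zreal (igram u v) :> R.
Proof. by rewrite /gram !rvec_dot /igram zrealB !zrealM expr2. Qed.

Lemma place_inord P i : (i < 15)%N -> place P (inord i) = rvec (corner P i).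
Proof. by move=> i15; rewrite /place inordK. Qed.

Lemma place_nondegenerate P t : t \in faces -> Z.eqb (tri_gram P t) 0 = false ->
  nondegenerate (place P) (triangle 15 t).
Proof.
move=> tF gt; have wt := allP faces_wf _ tF.
have /andP[_ /and4P[t1 t2 t3 _]] := wt.
have [tE tu] := triangleE wt.
exists (inord t.1.1), (inord t.1.2), (inord t.2); split=> //.
by rewrite !place_inord // !rvecB rvec_gram -[X in _ != X]zreal0 zreal_eq gt.
Qed.

Lemma points_nondegenerate s : s \in double_steffen -> nondegenerate (place points) s.
Proof.
move=> /complexP[t tF ->]; apply: place_nondegenerate => //.
have /allP/(_ _ tF)/negbTE // : all (fun t => ~~ Z.eqb (tri_gram points t) 0) faces.
by vm_compute.
Qed.

Lemma points_embedded : no_self_intersections double_steffen (plmap (place points)).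
Proof.
apply: plmap_no_self_intersections; first exact: points_nondegenerate.
by apply: faces_separated; vm_compute.
Qed.

Local Notation Q := convex_points.

(** The functional dot (tri_normal t) takes the value tri_det t on the whole
    plane of t, so that their quotient is the facet functional. *)
Definition tri_normal (t : tri) : ivec :=
  let a := corner Q t.1.1 in let b := corner Q t.1.2 in let c := corner Q t.2 in
  iadd (iadd (icross a b) (icross b c)) (icross c a).
Definition tri_det (t : tri) : Z :=
  idot (corner Q t.1.1) (icross (corner Q t.1.2) (corner Q t.2)).

Lemma tri_det_gt0 t : t \in faces -> Z.ltb 0 (tri_det t).
Proof.
move=> tF; have /allP/(_ _ tF) // : all (fun t => Z.ltb 0 (tri_det t)) faces.
by vm_compute.
Qed.

(** Convexity of the polytope, checked face by face. *)
Lemma tri_normal_convex t (i : 'I_15) : t \in faces ->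
  if (i : nat) \in corners t then Z.eqb (idot (tri_normal t) (corner Q i)) (tri_det t)
  else Z.ltb (idot (tri_normal t) (corner Q i)) (tri_det t).
Proof.
move=> tF; have : all (fun t => all (fun i =>
   let e := idot (tri_normal t) (corner Q i) in
   if i \in corners t then Z.eqb e (tri_det t) else Z.ltb e (tri_det t)) (iota 0 15)) faces.
  by vm_compute.
by move=> /allP/(_ _ tF)/allP/(_ i); apply; rewrite mem_iota /=.
Qed.

Lemma faces_closed t i : t \in faces -> i \in corners t -> exists2 t', t' \in faces &
  i \notin corners t' /\ forall j, j \in corners t -> j != i -> j \in corners t'.
Proof.
move=> tF it; have : all (fun t => all (fun i => has (fun t' =>
   (i \notin corners t') && all (fun j => (j == i) || (j \in corners t')) (corners t))
   faces) (corners t)) faces by vm_compute.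
move=> /allP/(_ _ tF)/allP/(_ _ it)/hasP[t' t'F /andP[it' /allP sub]].
by exists t' => //; split=> // j /sub/orP[/eqP->|//]; rewrite eqxx.
Qed.

Definition face_of (s : {set 'I_15}) : tri :=
  nth (0, 0, 0)%N faces (index s (map (triangle 15) faces)).

Lemma face_ofP s : s \in double_steffen -> face_of s \in faces /\ s = triangle 15 (face_of s).
Proof.
rewrite inE => sK; have lt : (index s (map (triangle 15) faces) < size faces)%N.
  by rewrite -(size_map (triangle 15)) index_mem.
split; first exact: mem_nth.
by rewrite -(nth_map _ (triangle 15 (0, 0, 0)%N)) // nth_index.
Qed.

Lemma cramer3 (a b c x : 'rV[R]_3) :
  dot a (cross b c) *: x = dot x (cross b c) *: a + dot x (cross c a) *: b
    + dot x (cross a b) *: c.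
Proof. by apply: row3P; rewrite !mxE !dot3E !row3E; ring. Qed.

Lemma rvec_cross u v : cross (rvec u) (rvec v) = rvec (icross u v) :> 'rV[R]_3.
Proof. by apply: row3P; rewrite !row3E zrealB !zrealM. Qed.

Lemma plmapD m n (p : 'I_m -> 'rV[R]_n) x y : plmap p (x + y) = plmap p x + plmap p y.
Proof. by rewrite -big_split; apply: eq_bigr => i _; rewrite mxE scalerDl. Qed.

Lemma plmapZ m n (p : 'I_m -> 'rV[R]_n) a x : plmap p (a *: x) = a *: plmap p x.
Proof. by rewrite scaler_sumr; apply: eq_bigr => i _; rewrite mxE scalerA. Qed.

Lemma complex_sphere : homeomorphic (@realization R 15 double_steffen) (@unit_sphere R).
Proof.
have det0 s : s \in double_steffen -> 0 < zreal (tri_det (face_of s)) :> R.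
  by move=> /face_ofP[/tri_det_gt0 d0 _]; rewrite -zreal0 zreal_lt.
have nE s i : s \in double_steffen ->
    dot ((zreal (tri_det (face_of s)))^-1 *: rvec (tri_normal (face_of s))) (place Q i) =
    zreal (idot (tri_normal (face_of s)) (corner Q i)) / zreal (tri_det (face_of s)).
  by move=> sK; rewrite dotZl rvec_dot mulrC.
apply: (@convex_sphere R 15 double_steffen (place Q)
  (fun s => (zreal (tri_det (face_of s)))^-1 *: rvec (tri_normal (face_of s)))
  (triangle 15 (1, 2, 4)%N)).
- by apply/complexP; exists (1, 2, 4)%N.
- move=> s i sK; rewrite nE // ler_pdivrMr ?det0 // mul1r zreal_le.
  have [/(@tri_normal_convex _ i) + _] := face_ofP sK.
  by case: ifP => _; lia.
- move=> s i sK; rewrite nE // eq_sym -(inj_eq (mulIf (lt0r_neq0 (det0 s sK)))).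
  rewrite divfK ?lt0r_neq0 ?det0 // mul1r zreal_eq.
  have [/(@tri_normal_convex _ i) + sE] := face_ofP sK.
  by rewrite [in RHS]sE [i \in triangle _ _]inE; case: ifP => _; lia.
- move=> s y sK; have d0 := det0 s sK; have [/(allP faces_wf) wt sE] := face_ofP sK.
  have /andP[_ /and4P[t1 t2 t3 _]] := wt.
  have [tE _] := triangleE wt; rewrite -sE in tE.
  set t := face_of s in wt t1 t2 t3 tE d0 *.
  pose a := rvec (corner Q t.1.1) : 'rV[R]_3; pose b := rvec (corner Q t.1.2) : 'rV[R]_3.
  pose c := rvec (corner Q t.2) : 'rV[R]_3.
  pose v i := @vertex R 15 (inord i).
  exists ((zreal (tri_det t))^-1 *: (dot y (cross b c) *: v t.1.1 +
      dot y (cross c a) *: v t.1.2 + dot y (cross a b) *: v t.2)).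
    move=> i; rewrite tE !inE !negb_or => /andP[/andP[ia ib] ic].
    by rewrite !mxE /= (negPf ia) (negPf ib) (negPf ic) !mulr0 !addr0 mulr0.
  rewrite plmapZ !plmapD !plmapZ /v !plmap_vertex !place_inord //.
  rewrite -/a -/b -/c -cramer3 scalerA /a /b /c rvec_cross rvec_dot mulVf ?scale1r //.
  exact: lt0r_neq0.
- move=> s i sK si; have [tF sE] := face_ofP sK.
  have : (i : nat) \in corners (face_of s) by move: si; rewrite {1}sE inE.
  move=> /(faces_closed tF)[t' t'F [it' sub]].
  exists (triangle 15 t'); first by apply/complexP; exists t'.
  split; first by rewrite inE.
  move=> j; rewrite {1}sE inE => js ji; rewrite inE; exact: sub.
Qed.

End Realize.

(** * Smooth motions and half-turns *)

Section Smooth.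
Context {R : realType}.
Implicit Types (f g : R -> R) (p q : R -> 'rV[R]_3).

(** Differentiability is used at time 0 only; a flex requires continuity near 0. *)
Definition smooth f : Prop :=
  derivable f 0 1 /\ \forall t \near 0, continuous_at t f.

Lemma smooth_cst (a : R) : smooth (fun=> a).
Proof.
split; first exact: derivable_cst.
by near=> t; exact: for_continuous_cst.
Unshelve. all: by end_near.
Qed.

Lemma smooth_id : smooth id.
Proof.
split; first exact: derivable_id.
by near=> t => P.
Unshelve. all: by end_near. Qed.

Lemma smoothD f g : smooth f -> smooth g -> smooth (fun t => f t + g t).
Proof.
move=> [df cf] [dg cg]; split; first exact: derivableD.
by near=> t; apply: for_continuousD; near: t.
Unshelve. all: by end_near. Qed.

Lemma smoothB f g : smooth f -> smooth g -> smooth (fun t => f t - g t).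
Proof.
move=> [df cf] [dg cg]; split; first exact: derivableB.
by near=> t; apply: for_continuousB; near: t.
Unshelve. all: by end_near. Qed.

Lemma smoothM f g : smooth f -> smooth g -> smooth (fun t => f t * g t).
Proof.
move=> [df cf] [dg cg]; split; first exact: derivableM.
by near=> t; apply: for_continuousM; near: t.
Unshelve. all: by end_near. Qed.

Lemma smooth_cvg f : smooth f -> f x @[x --> 0] --> f 0.
Proof. by move=> [_ /nbhs_singleton]. Qed.

Lemma smooth_gt0 f : smooth f -> 0 < f 0 -> \forall t \near 0, 0 < f t.
Proof. move=> /smooth_cvg cf f0; near=> t; near: t.
by apply: (cf [set y | 0 < y]); exact: lt_nbhsr.
Unshelve. all: by end_near. Qed.

Lemma smooth_neq0 f : smooth f -> f 0 != 0 -> \forall t \near 0, f t != 0.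
Proof.
move=> sf f0; have := smooth_gt0 (smoothM sf sf).
rewrite -expr2 lt_def sqr_ge0 sqrf_eq0 f0 => /(_ isT); apply: filterS => t.
by apply: contraTneq => ->; rewrite mulr0 ltxx.
Qed.

Lemma smoothV f : smooth f -> f 0 != 0 -> smooth (fun t => (f t)^-1).
Proof.
move=> sf f0; have [df cf] := sf; split; first exact: derivableV.
have nf := smooth_neq0 sf f0.
by near=> t; apply: for_continuousV; near: t.
Unshelve. all: by end_near. Qed.

Lemma smooth_sqrt f : smooth f -> 0 < f 0 -> smooth (fun t => Num.sqrt (f t)).
Proof.
move=> [df cf] f0; split; last first.
  by near=> t; apply: for_continuous_sqrt; near: t.
apply/derivable1_diffP; apply: (@differentiable_comp _ _ _ _ f Num.sqrt).
  exact/derivable1_diffP.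
by apply/derivable1_diffP; have [] := is_derive1_sqrt f0.
Unshelve. all: by end_near. Qed.

Definition vsmooth p : Prop := forall i, smooth (fun t => p t 0 i).

Definition velocity p : 'rV[R]_3 := \row_i 'D_1 (fun t => p t 0 i) 0.

Lemma vsmooth_cst (a : 'rV[R]_3) : vsmooth (fun=> a).
Proof. by move=> i; exact: smooth_cst. Qed.

Lemma vsmoothD p q : vsmooth p -> vsmooth q -> vsmooth (fun t => p t + q t).
Proof.
move=> sp sq i; rewrite (_ : (fun t => _) = (fun t => p t 0 i + q t 0 i)).
  exact: smoothD.
by apply/funext => t; rewrite mxE.
Qed.

Lemma vsmoothZ f p : smooth f -> vsmooth p -> vsmooth (fun t => f t *: p t).
Proof.
move=> sf sp i; rewrite (_ : (fun t => _) = (fun t => f t * p t 0 i)).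
  exact: smoothM.
by apply/funext => t; rewrite mxE.
Qed.

Lemma vsmoothB p q : vsmooth p -> vsmooth q -> vsmooth (fun t => p t - q t).
Proof.
move=> sp sq i; rewrite (_ : (fun t => _) = (fun t => p t 0 i - q t 0 i)).
  exact: smoothB.
by apply/funext => t; rewrite !mxE.
Qed.

Lemma smooth_dot p q : vsmooth p -> vsmooth q -> smooth (fun t => dot (p t) (q t)).
Proof.
move=> sp sq; rewrite (_ : (fun t => _) = (fun t => p t 0 0 * q t 0 0 +
    p t 0 1 * q t 0 1 + p t 0 2%:R * q t 0 2%:R)).
  by apply: smoothD; [apply: smoothD|]; apply: smoothM.
by apply/funext => t; rewrite dot3E.
Qed.

Lemma vsmooth_row3 f g h : smooth f -> smooth g -> smooth h ->
  vsmooth (fun t => row3 (f t) (g t) (h t)).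
Proof.
move=> sf sg sh i; under eq_fun do rewrite mxE.
by case: i => -[|[|[|//]]].
Qed.

Lemma vsmooth_cross p q : vsmooth p -> vsmooth q ->
  vsmooth (fun t => cross (p t) (q t)).
Proof.
by move=> sp sq; apply: vsmooth_row3; apply: smoothB; apply: smoothM.
Qed.

Lemma vsmooth_continuous p : vsmooth p -> \forall t \near 0, continuous_at t p.
Proof.
move=> sp; have [_ c0] := sp 0; have [_ c1] := sp 1; have [_ c2] := sp 2%:R.
near=> t; have c0t : continuous_at t (fun t => p t 0 0) by near: t.
have c1t : continuous_at t (fun t => p t 0 1) by near: t.
have c2t : continuous_at t (fun t => p t 0 2%:R) by near: t.
apply: row_continuous => -[[|[|[|//]]] ilt].
- by rewrite (_ : Ordinal ilt = 0) //; apply/val_inj.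
- by rewrite (_ : Ordinal ilt = 1) //; apply/val_inj.
- by rewrite (_ : Ordinal ilt = 2%:R) //; apply/val_inj.
Unshelve. all: by end_near. Qed.

Lemma is_derive_sqdist p q : vsmooth p -> vsmooth q ->
  is_derive (0 : R) 1 (fun t => sqdist (p t) (q t))
    (2 * dot (p 0 - q 0) (velocity p - velocity q)).
Proof.
move=> sp sq.
rewrite (_ : (fun t => _) = (fun t => (p t 0 0 - q t 0 0) ^+ 2 +
    (p t 0 1 - q t 0 1) ^+ 2 + (p t 0 2%:R - q t 0 2%:R) ^+ 2)); last first.
  by apply/funext => t; rewrite /sqdist dot3E !mxE -!expr2.
have dp i : is_derive (0 : R) 1 (fun t => p t 0 i) (velocity p 0 i).
  by rewrite mxE; apply: derivableP; have [] := sp i.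
have dq i : is_derive (0 : R) 1 (fun t => q t 0 i) (velocity q 0 i).
  by rewrite mxE; apply: derivableP; have [] := sq i.
have dd i : is_derive (0 : R) 1 (fun t => (p t 0 i - q t 0 i) ^+ 2)
    (2 * ((p 0 0 i - q 0 0 i) * (velocity p 0 i - velocity q 0 i))).
  have db := is_deriveB (dp i) (dq i).
  refine (is_derive_eq (is_deriveM db db) _).
  by rewrite /GRing.scale /= !fctE; ring.
refine (is_derive_eq (is_deriveD (is_deriveD (dd 0) (dd 1)) (dd 2%:R)) _).
by rewrite dot3E !mxE; ring.
Qed.

Lemma is_derive_gt0 f (a : R) : is_derive (0 : R) 1 f a -> 0 < a ->
  exists2 d : R, 0 < d & forall t, 0 < t < d -> f 0 < f t.
Proof.
move=> df a0; have [dv ea] := df; have := dv; rewrite /derivable.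
move/cvg_ex => [l cl]; have la : l = a by rewrite -ea /derive; exact/esym/cvg_lim.
rewrite la in cl.
have : nbhs (0 : R) [set t | t != 0 -> 0 < t^-1 *: ((f \o shift 0) t%:A - f 0)].
  exact: cvgr_gt a cl _ a0.
move=> /nbhs_ballP [d /= d0 dP]; exists d => // t /andP[t0 td].
have := dP t; rewrite /ball /= sub0r normrN gtr0_norm // => /(_ td (lt0r_neq0 t0)).
by rewrite /GRing.scale /= mulr1 addr0 pmulr_rgt0 ?invr_gt0 // subr_gt0.
Qed.

Lemma is_derive_neq0 f (a : R) : is_derive (0 : R) 1 f a -> a != 0 ->
  exists2 d : R, 0 < d & forall t, 0 < t < d -> f t != f 0.
Proof.
move=> df; rewrite neq_lt => /orP[a0|a0].
  have dNf := is_deriveN df; have := is_derive_gt0 dNf.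
  rewrite oppr_gt0 => /(_ a0)[d d0 dP]; exists d => // t /dP.
  by rewrite !fctE ltrN2 => /lt_eqF ->.
by have [d d0 dP] := is_derive_gt0 df a0; exists d => // t /dP/gt_eqF ->.
Qed.

(** First-order rigidity of a bar: the endpoints of a bar of constant length
    have the same velocity component along the bar. *)
Lemma sqdist_const_velocity p q : vsmooth p -> vsmooth q ->
  (\forall t \near 0, sqdist (p t) (q t) = sqdist (p 0) (q 0)) ->
  dot (p 0 - q 0) (velocity p - velocity q) = 0.
Proof.
move=> sp sq /nbhs_ballP[d /= d0 dP].
have df := is_derive_sqdist sp sq; apply/eqP/negPn/negP => n0.
have /(is_derive_neq0 df)[e e0 eP] : 2 * dot (p 0 - q 0) (velocity p - velocity q) != 0.
  by rewrite mulf_neq0 // pnatr_eq0.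
pose t := Num.min d e / 2.
have m0 : 0 < Num.min d e by rewrite lt_min d0.
have t0 : 0 < t by rewrite divr_gt0.
have tm : t < Num.min d e by rewrite /t; lra.
have := eP t; rewrite t0 (lt_le_trans tm) ?ge_min ?lexx ?orbT // => /(_ isT)/eqP; apply.
by apply: dP; rewrite /ball /= sub0r normrN gtr0_norm // (lt_le_trans tm) // ge_min lexx.
Qed.

End Smooth.

Section Crinkle.
Context {R : realType}.

Definition halfturn (M u x : 'rV[R]_3) : 'rV[R]_3 :=
  M + (2 * (dot (x - M) u / dot u u)) *: u - (x - M).

Lemma halfturnZ M u x (a : R) : a != 0 -> halfturn M (a *: u) x = halfturn M u x.
Proof.
move=> a0; rewrite /halfturn !(dotZr, dotZl) scalerA.
have [->|uu] := eqVneq u 0; first by rewrite !scaler0.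
congr (_ + _ *: _ - _); field; rewrite a0 /=.
by rewrite -dot_gt0 in uu; rewrite gt_eqF.
Qed.

Lemma halfturn_isometry M u x y : u != 0 ->
  sqdist (halfturn M u x) (halfturn M u y) = sqdist x y.
Proof.
rewrite -dot_gt0 => uu; rewrite /sqdist /halfturn.
set k := 2 * _; set l := 2 * _.
have -> : M + k *: u - (x - M) - (M + l *: u - (y - M)) = (k - l) *: u - (x - y).
  by apply/rowP => i; rewrite !mxE; ring.
have xy : k - l = 2 * dot (x - y) u / dot u u.
  by rewrite /k /l !dotBl; field; rewrite gt_eqF.
move: xy; move: (x - y) (k - l) => d a ->.
rewrite !(dotDl, dotDr, dotNl, dotNr, dotZl, dotZr) (dotC u); field.
by rewrite gt_eqF.
Qed.

Lemma halfturn_swap (A E u : 'rV[R]_3) : dot u (E - A) = 0 ->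
  halfturn (2^-1 *: (A + E)) u A = E.
Proof.
move=> uEA; rewrite /halfturn (_ : dot (A - _) u = 0) ?mul0r ?mulr0 ?scale0r ?addr0.
  by apply/rowP => i; rewrite !mxE; field.
rewrite (_ : A - _ = - 2^-1 *: (E - A)); last by apply/rowP => i; rewrite !mxE; field.
by rewrite dotZl dotC uEA mulr0.
Qed.

(** The right-hand side is symmetric in C and D, so C and D have the same distance
    from the image of the other. It involves the direction u only through a
    quotient of quadratic forms. *)
Lemma halfturn_sqdist (C D M u : 'rV[R]_3) : u != 0 ->
  sqdist C (halfturn M u D) = dot (C + D - 2 *: M) (C + D - 2 *: M)
    - 4 * (dot (C - M) u * dot (D - M) u / dot u u).
Proof.
rewrite -dot_gt0 => uu; rewrite /sqdist /halfturn.
set k := 2 * _.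
have -> : C - (M + k *: u - (D - M)) = (C - M + (D - M)) - k *: u.
  by apply/rowP => i; rewrite !mxE; ring.
have -> : C + D - 2 *: M = C - M + (D - M).
  by apply/rowP => i; rewrite !mxE; ring.
rewrite /k; move: (C - M) (D - M) => c d.
rewrite !(dotDl, dotDr, dotNl, dotNr, dotZl, dotZr) !(dotC u); field.
by rewrite gt_eqF.
Qed.

End Crinkle.

(** * Rotations about a fixed line *)

Section Rotation.
Context {R : realType}.

(** Rotation about the line through c with direction a by the angle whose half
    has tangent t |a|. This parametrization is rational in t and avoids the
    length of a. *)
Definition rotate (c a x : 'rV[R]_3) (t : R) : 'rV[R]_3 :=
  let r := x - c in let k := 2 * (1 + t ^+ 2 * dot a a)^-1 in
  x + (t * k) *: cross a r + (t * (t * k)) *: cross a (cross a r).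

Lemma rotate_den (a : 'rV[R]_3) t : 1 + t ^+ 2 * dot a a != 0.
Proof. by rewrite gt_eqF // ltr_pwDl // mulr_ge0 ?sqr_ge0 ?dot_ge0. Qed.

Lemma rotate0 c a x : rotate c a x 0 = x.
Proof. by rewrite /rotate !mul0r !scale0r !addr0. Qed.

Lemma rotate_sqdist c a x s t :
  sqdist (rotate c a x t) (c + s *: a) = sqdist x (c + s *: a).
Proof.
have D0 := rotate_den a t; rewrite /rotate /sqdist.
set r := x - c; set k := 2 * _.
have -> : x - (c + s *: a) = r - s *: a by rewrite /r opprD addrA.
have -> : x + (t * k) *: cross a r + (t * (t * k)) *: cross a (cross a r)
    - (c + s *: a) = (r - s *: a) + (t * k) *: cross a r
    + (t * (t * k)) *: cross a (cross a r).
  by rewrite /r; apply/rowP => i; rewrite !mxE; ring.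
have hk : k * (1 + t ^+ 2 * dot a a) = 2 by rewrite /k divfK.
move: r k hk => r k hk.
have cr (y z : 'rV[R]_3) : dot (cross a y) z = - dot y (cross a z).
  by rewrite !dot3E !row3E; ring.
have caa : cross a a = 0.
  by apply: row3P; rewrite row3E mxE; ring.
have c1 : dot (cross a r) (r - s *: a) = 0.
  by rewrite dot3E !row3E !mxE; ring.
have c2 : dot (cross a (cross a r)) (r - s *: a) = - dot (cross a r) (cross a r).
  by rewrite !dot3E !row3E !mxE; ring.
have c3 : dot (cross a (cross a r)) (cross a r) = 0.
  by rewrite !dot3E !row3E; ring.
have c4 : dot (cross a (cross a r)) (cross a (cross a r)) = dot a a * dot (cross a r) (cross a r).
  by rewrite !dot3E !row3E; ring.
move: (r - s *: a) (cross a r) (cross a (cross a r)) c1 c2 c3 c4 => y u v c1 c2 c3 c4.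
rewrite !(dotDl, dotDr, dotZl, dotZr) (dotC y u) (dotC y v) (dotC u v) c1 c2 c3 c4.
have : dot u u * (t ^+ 2 * k * (k * (1 + t ^+ 2 * dot a a) - 2)) = 0.
  by rewrite hk subrr !mulr0.
by move=> e; apply: subr0_eq; rewrite -[RHS]e; ring.
Qed.

Lemma smooth_rotate_coef (a : 'rV[R]_3) : smooth (fun t => 2 * (1 + t ^+ 2 * dot a a)^-1).
Proof.
apply: smoothM; first exact: smooth_cst.
apply: smoothV; last exact: rotate_den.
apply: smoothD; first exact: smooth_cst.
apply: smoothM; last exact: smooth_cst.
by apply: smoothM; exact: smooth_id.
Qed.

Lemma rotate_vsmooth c a x : vsmooth (rotate c a x).
Proof.
have sk := smooth_rotate_coef a.
have stk : smooth (fun t => t * (2 * (1 + t ^+ 2 * dot a a)^-1)).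
  exact: smoothM smooth_id sk.
rewrite /rotate; apply: vsmoothD; first apply: vsmoothD.
- exact: vsmooth_cst.
- by apply: vsmoothZ => //; exact: vsmooth_cst.
- apply: vsmoothZ; last exact: vsmooth_cst.
  exact: smoothM smooth_id stk.
Qed.

Lemma is_derive_mul_id (f : R -> R) : smooth f ->
  is_derive (0 : R) 1 (fun t => t * f t) (f 0).
Proof.
move=> [df _]; refine (is_derive_eq (is_deriveM (is_derive_id _ _) (derivableP df)) _).
by rewrite /GRing.scale /= mul0r add0r mulr1.
Qed.

Lemma rotate_velocity c a x : velocity (rotate c a x) = 2 *: cross a (x - c).
Proof.
have sk := smooth_rotate_coef a; have dk := is_derive_mul_id sk.
have stk : smooth (fun t => t * (2 * (1 + t ^+ 2 * dot a a)^-1)).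
  exact: smoothM smooth_id sk.
have dtk := is_derive_mul_id stk.
apply/rowP => i; rewrite [LHS]mxE [RHS]mxE; apply: derive_val.
rewrite (_ : (fun t => _) = (fun t => x 0 i +
   (cross a (x - c) 0 i * (t * (2 * (1 + t ^+ 2 * dot a a)^-1)) +
   cross a (cross a (x - c)) 0 i * (t * (t * (2 * (1 + t ^+ 2 * dot a a)^-1)))))); last first.
  by apply/funext => t; rewrite /rotate !mxE; ring.
refine (is_derive_eq (is_deriveD (is_derive_cst _ _ _) (is_deriveD
  (is_deriveZ (cross a (x - c) 0 i) dk) (is_deriveZ (cross a (cross a (x - c)) 0 i) dtk))) _).
by rewrite expr0n /= mul0r addr0 invr1 /GRing.scale /=; ring.
Qed.

End Rotation.

(** * The flex of a crinkle *)

Section CrinkleFlex.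
Context {R : realType}.

(** The axis direction at time t is sought as u = e1 + w e2, where e1 and e2 are
    orthogonal and span the plane orthogonal to AE. Keeping |CD'| means that
    dot (C - M) u * dot (D - M) u = k dot u u, where M is the midpoint of AE and
    k compensates for the change of |C + D - 2 M|^2. This is a quadratic equation
    al w^2 + be w + ga = 0 with ga = 0 at time 0, and the last hypothesis, that be
    is not 0 at time 0, says that its root w = 0 is simple. *)
Lemma crinkle_flex (C D A : 'rV[R]_3) (E : R -> 'rV[R]_3) (u0 : 'rV[R]_3) :
  let M0 := 2^-1 *: (A + E 0) in let v0 := cross (E 0 - A) u0 in
  vsmooth E -> u0 != 0 -> E 0 - A != 0 -> dot u0 (E 0 - A) = 0 ->
  dot (C - M0) u0 * dot (D - M0) v0 + dot (C - M0) v0 * dot (D - M0) u0 != 0 ->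
  exists C' D' : R -> 'rV[R]_3, [/\ vsmooth C', vsmooth D',
    C' 0 = halfturn M0 u0 C, D' 0 = halfturn M0 u0 D &
    \forall t \near 0,
      [/\ sqdist A (C' t) = sqdist (E t) C, sqdist A (D' t) = sqdist (E t) D,
          sqdist (E t) (C' t) = sqdist A C, sqdist (E t) (D' t) = sqdist A D &
          [/\ sqdist (C' t) (D' t) = sqdist C D,
          sqdist C (D' t) = sqdist C (D' 0) &
          sqdist D (C' t) = sqdist D (C' 0)]]].
Proof.
move=> M0 v0 sE u00 d00 u0d nu0.
set nu := _ + _ in nu0.
pose d t := E t - A.
have sd : vsmooth d by apply: vsmoothB => //; exact: vsmooth_cst.
pose M t := 2^-1 *: (A + E t).
have sM : vsmooth M.
  by apply: (vsmoothZ (smooth_cst _)); apply: vsmoothD => //; exact: vsmooth_cst.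
(* The part of u0 orthogonal to AE, scaled by |AE|^2 to avoid a division. *)
pose e1 t := dot (d t) (d t) *: u0 - dot u0 (d t) *: d t.
(* The factor nu makes be 0 positive, so that the signs of be and of the square
   root agree in the formula for w. *)
pose e2 t := nu *: cross (d t) u0.
have su0 := vsmooth_cst u0.
have se1 : vsmooth e1.
  by apply: vsmoothB; apply: vsmoothZ => //; exact: smooth_dot.
have se2 : vsmooth e2.
  by apply: (vsmoothZ (smooth_cst _)); exact: vsmooth_cross.
have e1d t : dot (e1 t) (d t) = 0.
  by rewrite /e1 dotBl !dotZl; ring.
have e2d t : dot (e2 t) (d t) = 0.
  by rewrite /e2 dotZl dot3E !row3E; ring.
have e12 t : dot (e1 t) (e2 t) = 0.
  by rewrite /e1 /e2 dotZr dotBl !dotZl !dot3E !row3E; ring.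
have sC : vsmooth (fun t => C - M t) by apply: vsmoothB => //; exact: vsmooth_cst.
have sD : vsmooth (fun t => D - M t) by apply: vsmoothB => //; exact: vsmooth_cst.
pose S t := C + D - 2 *: M t.
have sS : vsmooth S.
  by apply: vsmoothB; [exact: vsmooth_cst|apply: (vsmoothZ (smooth_cst _))].
pose k0 := dot (C - M0) u0 * dot (D - M0) u0 / dot u0 u0.
pose k t := k0 + (dot (S t) (S t) - dot (S 0) (S 0)) / 4.
have sk : smooth k.
  apply: smoothD; first exact: smooth_cst.
  apply: smoothM; last exact: smooth_cst.
  by apply: smoothB; [exact: smooth_dot|exact: smooth_cst].
pose al t := dot (C - M t) (e2 t) * dot (D - M t) (e2 t) - k t * dot (e2 t) (e2 t).
pose be t := dot (C - M t) (e1 t) * dot (D - M t) (e2 t) +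
             dot (C - M t) (e2 t) * dot (D - M t) (e1 t).
pose ga t := dot (C - M t) (e1 t) * dot (D - M t) (e1 t) - k t * dot (e1 t) (e1 t).
have sal : smooth al.
  by apply: smoothB; apply: smoothM => //; exact: smooth_dot.
have sbe : smooth be.
  by apply: smoothD; apply: smoothM; exact: smooth_dot.
have sga : smooth ga.
  by apply: smoothB; apply: smoothM => //; exact: smooth_dot.
pose dd := dot (d 0) (d 0).
have dd0 : 0 < dd by rewrite dot_gt0.
have e10 : e1 0 = dd *: u0 by rewrite /e1 u0d scale0r subr0.
have k00 : k 0 = k0 by rewrite /k subrr mul0r addr0.
have uu0 : dot u0 u0 != 0 by rewrite dot_eq0.
have ga0 : ga 0 = 0.
  by rewrite /ga k00 e10 !dotZr !dotZl /k0; field.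
have be0 : be 0 = dd * nu ^+ 2.
  by rewrite /be e10 /e2 !dotZr /nu; ring.
have be0_gt0 : 0 < be 0 by rewrite be0 mulr_gt0 // lt_def sqr_ge0 sqrf_eq0 nu0.
pose disc t := be t * be t - 4 * (al t * ga t).
have sdisc : smooth disc.
  apply: smoothB; first exact: smoothM.
  by apply: smoothM; [exact: smooth_cst|exact: smoothM].
have disc0 : disc 0 = be 0 ^+ 2 by rewrite /disc ga0; ring.
have disc0_gt0 : 0 < disc 0 by rewrite disc0 exprn_gt0.
pose den t := be t + Num.sqrt (disc t).
have sden : smooth den by apply: smoothD => //; exact: smooth_sqrt.
have den0 : den 0 != 0 by rewrite gt_eqF // ltr_wpDr // sqrtr_ge0.
(* The root that vanishes together with ga; this form does not divide by al,
   which may be 0. *)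
pose w t := - 2 * (ga t * (den t)^-1).
have sw : smooth w.
  apply: smoothM; first exact: smooth_cst.
  by apply: smoothM => //; exact: smoothV.
have w0 : w 0 = 0 by rewrite /w ga0 mul0r mulr0.
pose u t := e1 t + w t *: e2 t.
have su : vsmooth u by apply: vsmoothD => //; exact: vsmoothZ.
have u0E : u 0 = dd *: u0 by rewrite /u w0 scale0r addr0.
have uu : dot (u 0) (u 0) != 0.
  by rewrite dot_eq0 u0E scaler_eq0 negb_or u00 gt_eqF.
have suu := smooth_dot su su.
have sH x : vsmooth (fun t => halfturn (M t) (u t) x).
  have sx : vsmooth (fun t => x - M t) by apply: vsmoothB => //; exact: vsmooth_cst.
  rewrite /halfturn; apply: vsmoothB => //; apply: vsmoothD => //.
  apply: vsmoothZ => //; apply: smoothM; first exact: smooth_cst.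
  by apply: smoothM; [exact: smooth_dot|exact: smoothV].
exists (fun t => halfturn (M t) (u t) C), (fun t => halfturn (M t) (u t) D).
have H0 x : halfturn (M 0) (u 0) x = halfturn M0 u0 x.
  by rewrite u0E halfturnZ // gt_eqF.
split; [exact: sH|exact: sH|exact: H0|exact: H0|].
have near_eq : \forall t \near 0, [/\ u t != 0 &
    dot (C - M t) (u t) * dot (D - M t) (u t) / dot (u t) (u t) = k t].
  have nuu := smooth_neq0 suu uu.
  have ndisc := smooth_gt0 sdisc disc0_gt0.
  have nden := smooth_neq0 sden den0.
  near=> t; have uut : dot (u t) (u t) != 0 by near: t.
  have disct : 0 < disc t by near: t.
  have dent : den t != 0 by near: t.
  split; first by rewrite -dot_eq0.
  apply: (mulIf uut); rewrite divfK //; apply/eqP; rewrite -subr_eq0; apply/eqP.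
  transitivity (al t * w t ^+ 2 + be t * w t + ga t).
    rewrite /u /al /be /ga; move: (e12 t) (w t) (k t).
    move: (C - M t) (D - M t) (e1 t) (e2 t) => c e a b ab x y.
    by rewrite !(dotDl, dotDr, dotZl, dotZr) (dotC b a) ab; ring.
  have s2 : Num.sqrt (disc t) ^+ 2 = be t * be t - 4 * (al t * ga t).
    by rewrite sqr_sqrtr // ltW.
  apply: (mulIf (expf_neq0 2 dent)); rewrite mul0r.
  transitivity (ga t * (4 * (al t * ga t) - 2 * be t * den t + den t ^+ 2)).
    by rewrite /w; field.
  rewrite (_ : _ + den t ^+ 2 = 4 * (al t * ga t) - be t * be t + Num.sqrt (disc t) ^+ 2).
    by rewrite s2; ring.
  by rewrite /den; ring.
have dSM t : dot (u t) (E t - A) = 0.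
  by rewrite -/(d t) /u dotDl dotZl e1d e2d mulr0 addr0.
have [u0n0 eq0] : u 0 != 0 /\ dot (C - M 0) (u 0) * dot (D - M 0) (u 0) / dot (u 0) (u 0) = k 0.
  by have [] := nbhs_singleton near_eq.
apply: filterS near_eq => t [ut0 eqt].
have HA := halfturn_swap (dSM t); rewrite -/(M t) in HA.
have iso x y := halfturn_isometry (M t) x y ut0.
have HE : halfturn (M t) (u t) (E t) = A.
  rewrite /M addrC; apply: halfturn_swap.
  by rewrite -opprB dotNr dSM oppr0.
cbv beta; split; [| | | |split].
- by rewrite -{1}HE iso.
- by rewrite -{1}HE iso.
- by rewrite -{1}HA iso.
- by rewrite -{1}HA iso.
- exact: iso.
- by rewrite !halfturn_sqdist // eqt eq0 /k -!/(S _); field.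
- rewrite !halfturn_sqdist // [dot (D - M t) _ * _]mulrC eqt [dot (D - M 0) _ * _]mulrC eq0 /k.
  by rewrite (addrC D) -!/(S _); field.
Unshelve. all: by end_near. Qed.

End CrinkleFlex.

(** * The motion of the polyhedron *)

Section CrinkleData.
Local Open Scope Z_scope.

Definition iscale (k : Z) (u : ivec) : ivec := (k * u.1.1, k * u.1.2, k * u.2).

(** The hypotheses of [crinkle_flex] for integer points, and that c' and d' are
    the images of c and d under the half-turn. All positions are taken relative
    to the midpoint of a and e and doubled, to stay within the integers. *)
Definition icrinkle (P : seq ivec) (c d a e : nat) (u : ivec) (c' d' : nat) : bool :=
  let ae := iadd (corner P a) (corner P e) in
  let off i := isub (iadd (corner P i) (corner P i)) ae in
  let x := off c in let y := off d in
  let r := isub (corner P e) (corner P a) in let v := icross r u in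
  let turned i i' :=
    iscale (idot u u) (isub (iadd (corner P i') (corner P i)) ae) ==
    iscale (idot (off i) u) u in
  [&& idot u r =? 0, ~~ (idot u u =? 0), ~~ (idot r r =? 0),
      ~~ (idot x u * idot y v + idot x v * idot y u =? 0),
      turned c c' & turned d d'].

(** Initial directions of the axes of the four half-turns. *)
Definition turn_axis1 : ivec := (1, -1, 2).
Definition turn_axis2 : ivec := (0, 1, -1).
Definition turn_axis3 : ivec := (3, 3, 1).
Definition turn_axis4 : ivec := (0, 1, 0).
(** Directions of the lines CD and BF. Their lengths set the speeds of E and G:
    the multiples are such that all initial velocities are integers. *)
Definition hinge1 : ivec := (351, 0, -468).
Definition hinge2 : ivec := (-1018, -509, 1527).

(** The velocities of the 15 vertices at time 0; see [velocities]. *)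
Definition rates : seq ivec := [::
  (0, 0, 0); (0, 0, 0); (0, 0, 0); (106704, -133380, 80028); (0, 0, 0);
  (0, 0, 0); (-116052, -986442, -406182); (-39520, -7904, -292448);
  (4446, 0, -4446); (12312, -30780, -55404); (106704, 40014, -93366);
  (-5580, 360, -18540); (469368, 70848, -22140); (0, 251446, -251446);
  (116052, 19342, -96710)].

End CrinkleData.

Section Motion.
Context {R : realType}.
Implicit Types (p : R -> nat -> 'rV[R]_3).

Local Notation pt i := (rvec (corner points i) : 'rV[R]_3).

Lemma rvecD u v : rvec u + rvec v = rvec (iadd u v) :> 'rV[R]_3.
Proof.
have addE (x y : 'rV[R]_3) i : (x + y) 0 i = x 0 i + y 0 i by rewrite !mxE.
by apply: row3P; rewrite addE !row3E zrealD.
Qed.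

Lemma rvecZ k u : zreal k *: rvec u = rvec (iscale k u) :> 'rV[R]_3.
Proof.
have scE a (x : 'rV[R]_3) i : (a *: x) 0 i = a * x 0 i by rewrite !mxE.
by apply: row3P; rewrite scE !row3E zrealM.
Qed.

Lemma zreal_neq0 z : ~~ (Z.eqb z 0) -> zreal z != 0 :> R.
Proof. by rewrite -[X in _ != X]zreal0 zreal_eq. Qed.

Lemma rvec_neq0 u : ~~ (Z.eqb (idot u u) 0) -> rvec u != 0 :> 'rV[R]_3.
Proof. by move=> /zreal_neq0; rewrite -dot_eq0 rvec_dot. Qed.

Lemma crinkle_data (c d a e c' d' : nat) (u : ivec) (E : R -> 'rV[R]_3) :
  icrinkle points c d a e u c' d' -> vsmooth E -> E 0 = pt e ->
  exists C' D' : R -> 'rV[R]_3, [/\ vsmooth C', vsmooth D',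
    C' 0 = pt c', D' 0 = pt d' &
    \forall t \near 0,
      [/\ sqdist (pt a) (C' t) = sqdist (E t) (pt c),
          sqdist (pt a) (D' t) = sqdist (E t) (pt d),
          sqdist (E t) (C' t) = sqdist (pt a) (pt c),
          sqdist (E t) (D' t) = sqdist (pt a) (pt d) &
          [/\ sqdist (C' t) (D' t) = sqdist (pt c) (pt d),
          sqdist (pt c) (D' t) = sqdist (pt c) (D' 0) &
          sqdist (pt d) (C' t) = sqdist (pt d) (C' 0)]]].
Proof.
rewrite /icrinkle; cbv zeta; set ae := iadd (corner _ a) (corner _ e).
set r := isub (corner _ e) (corner _ a).
move=> /and5P[ur uu rr nu /andP[tc td]] sE E0.
have M0E : 2^-1 *: (pt a + E 0) = 2^-1 *: rvec ae by rewrite E0 rvecD.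
have offE i : pt i - 2^-1 *: (pt a + E 0) =
    2^-1 *: rvec (isub (iadd (corner points i) (corner points i)) ae).
  by rewrite M0E -rvecB -rvecD; apply/rowP => j; rewrite !mxE; field.
have rE : E 0 - pt a = rvec r by rewrite E0 rvecB.
have turn i i' : iscale (idot u u) (isub (iadd (corner points i') (corner points i)) ae) ==
    iscale (idot (isub (iadd (corner points i) (corner points i)) ae) u) u ->
    halfturn (2^-1 *: (pt a + E 0)) (rvec u) (pt i) = pt i'.
  move=> /eqP /(congr1 (rvec : ivec -> 'rV[R]_3)); rewrite -!rvecZ => e1.
  have u0 : zreal (idot u u) != 0 :> R by exact: zreal_neq0.
  have e2 : pt i' = (zreal (idot u u))^-1 *: (zreal (idot (isub (iadd (corner points i) (corner points i)) ae) u) *: rvec u) - pt i + rvec ae.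
    rewrite -e1 scalerA mulVf // scale1r -rvecB -rvecD.
    by apply/rowP => j; rewrite !mxE; ring.
  rewrite e2 /halfturn offE M0E !dotZl !rvec_dot -rvecB -rvecD.
  by apply/rowP => j; rewrite !mxE; field.
have [] := @crinkle_flex R (pt c) (pt d) (pt a) E (rvec u) sE.
- exact: rvec_neq0.
- by rewrite rE rvec_neq0.
- by rewrite rE rvec_dot; apply/eqP; rewrite -[X in _ == X]zreal0 zreal_eq.
- rewrite !offE rE rvec_cross !dotZl !rvec_dot.
  have := zreal_neq0 nu; rewrite zrealD !zrealM => nu0.
  rewrite (_ : _ + _ = 4^-1 * (zreal (idot (isub (iadd (corner points c) (corner points c)) ae) u) *
         zreal (idot (isub (iadd (corner points d) (corner points d)) ae) (icross r u)) +
         zreal (idot (isub (iadd (corner points c) (corner points c)) ae) (icross r u)) *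
         zreal (idot (isub (iadd (corner points d) (corner points d)) ae) u))).
    by rewrite mulf_neq0 // invr_neq0 // pnatr_eq0.
  by field.
- move=> C' [D' [sC sD C0 D0 near]]; exists C', D'; split=> //.
  + by rewrite C0; exact: turn.
  + by rewrite D0; exact: turn.
Qed.

Definition rigid p i j : Prop :=
  \forall t \near 0, sqdist (p t i) (p t j) = sqdist (p 0 i) (p 0 j).

Lemma rigid_const p i j :
  (forall t, sqdist (p t i) (p t j) = sqdist (p 0 i) (p 0 j)) -> rigid p i j.
Proof. by move=> e; rewrite /rigid; near=> t; exact: e. Unshelve. all: by end_near. Qed.

Lemma rigid_sym p i j : rigid p i j -> rigid p j i.
Proof. by apply: filterS => t; rewrite !(sqdistC _ (p _ j)). Qed.

(** The edges of a crinkle that do not lie on its boundary. *)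
Definition crinkle_edges (c d a e c' d' : nat) : seq (nat * nat) :=
  [:: (a, c'); (a, d'); (e, c'); (e, d'); (c', d'); (c, d'); (d, c')].

Lemma crinkle_rigid p c d a e c' d' :
  (forall t, p t c = p 0 c) -> (forall t, p t d = p 0 d) ->
  (forall t, p t a = p 0 a) -> rigid p e c -> rigid p e d ->
  (\forall t \near 0,
      [/\ sqdist (p t a) (p t c') = sqdist (p t e) (p t c),
          sqdist (p t a) (p t d') = sqdist (p t e) (p t d),
          sqdist (p t e) (p t c') = sqdist (p t a) (p t c),
          sqdist (p t e) (p t d') = sqdist (p t a) (p t d) &
          [/\ sqdist (p t c') (p t d') = sqdist (p t c) (p t d),
          sqdist (p t c) (p t d') = sqdist (p t c) (p 0 d') &
          sqdist (p t d) (p t c') = sqdist (p t d) (p 0 c')]]) ->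
  forall i j, (i, j) \in crinkle_edges c d a e c' d' -> rigid p i j.
Proof.
move=> pc pd pa ec ed near i j.
have [a1 a2 a3 a4 [a5 a6 a7]] := nbhs_singleton near.
rewrite !inE => ij; apply: filterS (filterI near (filterI ec ed)) => t.
move=> [[b1 b2 b3 b4 [b5 b6 b7]] [ect edt]]; move: ij.
do 6?[case/orP]; move=> /eqP[-> ->].
- by rewrite b1 ect a1.
- by rewrite b2 edt a2.
- by rewrite b3 a3 pa pc.
- by rewrite b4 a4 pa pd.
- by rewrite b5 a5 pc pd.
- by rewrite b6 pc.
- by rewrite b7 pd.
Qed.

Definition fixed_vertices : seq nat := [:: 0; 1; 2; 4; 5]%N.

(** All pairs kept at constant distance: pairs of fixed vertices, the sides at
    the tips E and G of the hinges, and the interior edges of the crinkles. *)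
Definition edges : seq (nat * nat) :=
  [seq (i, j) | i <- fixed_vertices, j <- fixed_vertices] ++
  [:: (3, 0); (3, 1); (6, 4); (6, 5)]%N ++
  crinkle_edges 0 1 2 3 7 8 ++ crinkle_edges 0 1 4 3 9 10 ++
  crinkle_edges 4 5 2 6 11 12 ++ crinkle_edges 4 5 0 6 13 14.

Lemma face_edges t i j : t \in faces -> i \in corners t -> j \in corners t ->
  i = j \/ (i, j) \in edges \/ (j, i) \in edges.
Proof.
move=> tF it jt; have : all (fun t => all (fun i => all (fun j =>
    [|| i == j, (i, j) \in edges | (j, i) \in edges]) (corners t)) (corners t)) faces.
  by vm_compute.
move=> /allP/(_ _ tF)/allP/(_ _ it)/allP/(_ _ jt)/or3P[/eqP->|e|e].
- by left.
- by right; left.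
- by right; right.
Qed.

Lemma rotate_rigid (c d a x : ivec) (s : R) : rvec d = rvec c + s *: rvec a ->
  forall t, sqdist (rotate (rvec c) (rvec a) (rvec x) t) (rvec c : 'rV[R]_3) = sqdist (rvec x) (rvec c) /\
  sqdist (rotate (rvec c) (rvec a) (rvec x) t) (rvec d : 'rV[R]_3) = sqdist (rvec x) (rvec d).
Proof.
move=> -> t; split; last exact: rotate_sqdist.
by have := rotate_sqdist (rvec c) (rvec a) (rvec x) 0 t; rewrite scale0r addr0.
Qed.

Lemma rvec_on_line (c d a : ivec) : ~~ Z.eqb (idot a a) 0 ->
  icross (isub d c) a == (Z0, Z0, Z0) ->
  exists s : R, rvec d = rvec c + s *: rvec a.
Proof.
move=> /zreal_neq0 a0 /eqP cross0; exists (zreal (idot (isub d c) a) / zreal (idot a a)).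
have crossE : cross (rvec (isub d c)) (rvec a) = 0 :> 'rV[R]_3.
  by rewrite rvec_cross cross0; apply: row3P; rewrite row3E mxE zreal0.
rewrite -!rvec_dot -rvecB in crossE a0 *; move: (rvec c) (rvec d) crossE => x y crossE.
apply: (addrI (- x)); rewrite addrA addNr add0r addrC.
move: (y - x) crossE => z crossE; apply: (scalerI a0).
rewrite scalerA mulrCA divff // mulr1.
transitivity (dot z (rvec a) *: rvec a + cross (rvec a) (cross z (rvec a)) : 'rV[R]_3).
  by apply: row3P; rewrite !mxE /= !dot3E !row3E; ring.
rewrite crossE (_ : cross _ 0 = 0) ?addr0 //.
by apply: row3P; rewrite row3E !mxE; ring.
Qed.

(** The vertices 0, 1, 2, 4, 5 stay fixed, 3 rotates about the hinge 01 and 6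
    about the hinge 45; the other vertices follow by [crinkle_flex]. *)
Lemma motion_exists : exists p, [/\ forall i, vsmooth (fun t => p t i),
  forall i, (i < 15)%N -> p 0 i = pt i,
  forall i j, (i, j) \in edges -> rigid p i j,
  forall i t, i \in fixed_vertices -> p t i = pt i &
  velocity (fun t => p t 3%N) = rvec (corner rates 3) /\
  velocity (fun t => p t 6%N) = rvec (corner rates 6)].
Proof.
pose E1 := rotate (pt 0) (rvec hinge1) (pt 3).
pose E2 := rotate (pt 4) (rvec hinge2) (pt 6).
have sE1 : vsmooth E1 by exact: rotate_vsmooth.
have sE2 : vsmooth E2 by exact: rotate_vsmooth.
have E10 : E1 0 = pt 3 by exact: rotate0.
have E20 : E2 0 = pt 6 by exact: rotate0.
have E1r : forall t, sqdist (E1 t) (pt 0) = sqdist (pt 3) (pt 0) /\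
    sqdist (E1 t) (pt 1) = sqdist (pt 3) (pt 1).
  by have [|s] := @rvec_on_line (corner points 0) (corner points 1) hinge1 isT;
    [vm_compute|exact: rotate_rigid].
have E2r : forall t, sqdist (E2 t) (pt 4) = sqdist (pt 6) (pt 4) /\
    sqdist (E2 t) (pt 5) = sqdist (pt 6) (pt 5).
  by have [|s] := @rvec_on_line (corner points 4) (corner points 5) hinge2 isT;
    [vm_compute|exact: rotate_rigid].
have [C1 [D1 [sC1 sD1 C10 D10 near1]]] :=
  @crinkle_data 0 1 2 3 7 8 turn_axis1 E1 isT sE1 E10.
have [C2 [D2 [sC2 sD2 C20 D20 near2]]] :=
  @crinkle_data 0 1 4 3 9 10 turn_axis2 E1 isT sE1 E10.
have [C3 [D3 [sC3 sD3 C30 D30 near3]]] :=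
  @crinkle_data 4 5 2 6 11 12 turn_axis3 E2 isT sE2 E20.
have [C4 [D4 [sC4 sD4 C40 D40 near4]]] :=
  @crinkle_data 4 5 0 6 13 14 turn_axis4 E2 isT sE2 E20.
pose p t := nth 0 [:: pt 0; pt 1; pt 2; E1 t; pt 4; pt 5; E2 t; C1 t; D1 t;
  C2 t; D2 t; C3 t; D3 t; C4 t; D4 t].
have fixedP i t : i \in fixed_vertices -> p t i = pt i.
  by rewrite !inE => /or4P[/eqP->|/eqP->|/eqP->|/orP[]/eqP->].
have fixed0 i t : i \in fixed_vertices -> p t i = p 0 i.
  by move=> fi; rewrite !fixedP.
have r30 : rigid p 3 0 by apply: rigid_const => t; rewrite /p /= E10; have [] := E1r t.
have r31 : rigid p 3 1 by apply: rigid_const => t; rewrite /p /= E10; have [] := E1r t.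
have r64 : rigid p 6 4 by apply: rigid_const => t; rewrite /p /= E20; have [] := E2r t.
have r65 : rigid p 6 5 by apply: rigid_const => t; rewrite /p /= E20; have [] := E2r t.
exists p; split.
- do 3 (case=> [|]; first exact: vsmooth_cst); case=> [|]; first exact: sE1.
  do 2 (case=> [|]; first exact: vsmooth_cst); case=> [|]; first exact: sE2.
  case=> [|]; first exact: sC1; case=> [|]; first exact: sD1.
  case=> [|]; first exact: sC2; case=> [|]; first exact: sD2.
  case=> [|]; first exact: sC3; case=> [|]; first exact: sD3.
  case=> [|]; first exact: sC4; case=> [|]; first exact: sD4.
  by move=> i; rewrite /p /= (_ : (fun t => _) = fun=> 0);
    [exact: vsmooth_cst|apply/funext => t; rewrite nth_nil].
- do 3 (case=> [//|]); case=> [_|]; first exact: E10.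
  do 2 (case=> [//|]); case=> [_|]; first exact: E20.
  case=> [_|]; first exact: C10; case=> [_|]; first exact: D10.
  case=> [_|]; first exact: C20; case=> [_|]; first exact: D20.
  case=> [_|]; first exact: C30; case=> [_|]; first exact: D30.
  case=> [_|]; first exact: C40; case=> [_|]; first exact: D40.
  by [].
- move=> i j; rewrite mem_cat => /orP[/allpairsPdep[i' [j' [fi fj [-> ->]]]]|].
    by apply: rigid_const => t; rewrite !(fixed0 _ t).
  rewrite !mem_cat => /or4P[|||/orP[]].
  + by rewrite !inE => /or4P[] /eqP[-> ->].
  + by apply: (@crinkle_rigid p 0 1 2 3 7 8 _ _ _ _ _ near1 i j) => // t; exact: fixed0.
  + by apply: (@crinkle_rigid p 0 1 4 3 9 10 _ _ _ _ _ near2 i j) => // t; exact: fixed0.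
  + by apply: (@crinkle_rigid p 4 5 2 6 11 12 _ _ _ _ _ near3 i j) => // t; exact: fixed0.
  + by apply: (@crinkle_rigid p 4 5 0 6 13 14 _ _ _ _ _ near4 i j) => // t; exact: fixed0.
- exact: fixedP.
- split.
    rewrite (_ : (fun t => _) = E1) // rotate_velocity rvecB rvec_cross.
    by rewrite -[2]/(1 + 1) scalerDl scale1r rvecD.
  rewrite (_ : (fun t => _) = E2) // rotate_velocity rvecB rvec_cross.
  by rewrite -[2]/(1 + 1) scalerDl scale1r rvecD.
Qed.

End Motion.

(** * Velocities and the diameter *)

Section Velocities.
Context {R : realType}.
Variable p : R -> nat -> 'rV[R]_3.
Hypothesis sp : forall i, vsmooth (fun t => p t i).
Hypothesis p0 : forall i, (i < 15)%N -> p 0 i = rvec (corner points i).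
Hypothesis prigid : forall i j, (i, j) \in edges -> rigid p i j.
Hypothesis pfixed : forall i t, i \in fixed_vertices -> p t i = rvec (corner points i).
Hypothesis v3 : velocity (fun t => p t 3%N) = rvec (corner rates 3).
Hypothesis v6 : velocity (fun t => p t 6%N) = rvec (corner rates 6).

Let vel i := velocity (fun t => p t i).

Lemma perp3 (a b c x : 'rV[R]_3) : dot a (cross b c) != 0 ->
  dot a x = 0 -> dot b x = 0 -> dot c x = 0 -> x = 0.
Proof.
move=> d0 ax bx cx; apply: (scalerI d0); rewrite scaler0.
transitivity (dot a x *: cross b c + dot b x *: cross c a + dot c x *: cross a b).
  by apply: row3P; rewrite !mxE /= !dot3E !row3E; ring.
by rewrite ax bx cx !scale0r !addr0.
Qed.

Definition bar i j : ivec := isub (corner points i) (corner points j).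

(** Half the derivative at time 0 of the squared distance. *)
Definition stretch i j : Z := idot (bar i j) (isub (corner rates i) (corner rates j)).

Let rigid_velocity i j : (i < 15)%N -> (j < 15)%N -> rigid p i j ->
  dot (rvec (bar i j)) (vel i - vel j) = 0.
Proof.
move=> i15 j15 rij; have := sqdist_const_velocity (sp i) (sp j) rij.
by rewrite !p0 // rvecB.
Qed.

(** The velocity of a vertex attached by three rigid bars in independent
    directions to vertices of known velocity is the solution of a regular system
    of three linear equations. *)
Let vel_unique i j k l : (i < 15)%N -> (j < 15)%N -> (k < 15)%N -> (l < 15)%N ->
  (j, i) \in edges -> (k, i) \in edges -> (l, i) \in edges ->
  vel j = rvec (corner rates j) -> vel k = rvec (corner rates k) -> vel l = rvec (corner rates l) ->
  [&& Z.eqb (stretch i j) 0, Z.eqb (stretch i k) 0, Z.eqb (stretch i l) 0 &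
   ~~ Z.eqb (idot (bar i j) (icross (bar i k) (bar i l))) 0] ->
  vel i = rvec (corner rates i).
Proof.
move=> i15 j15 k15 l15 ej ek el vj vk vl /and4P[cj ck cl d0].
have orth h : (h < 15)%N -> (h, i) \in edges -> vel h = rvec (corner rates h) -> Z.eqb (stretch i h) 0 ->
    dot (rvec (bar i h)) (vel i - rvec (corner rates i)) = 0.
  move=> h15 eh vh ch.
  have := rigid_velocity i15 h15 (rigid_sym (prigid eh)); rewrite vh.
  have : dot (rvec (bar i h)) (rvec (corner rates i) - rvec (corner rates h)) = 0 :> R.
    by rewrite rvecB rvec_dot; apply/eqP; rewrite -[X in _ == X]zreal0 zreal_eq.
  move: (vel i) (rvec (corner rates i)) (rvec (corner rates h)) => x y z.
  by rewrite !dotBr => /subr0_eq -> /subr0_eq ->; rewrite subrr.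
apply/eqP; rewrite -subr_eq0; apply/eqP.
apply: (@perp3 (rvec (bar i j)) (rvec (bar i k)) (rvec (bar i l))).
- by rewrite rvec_cross rvec_dot; exact: zreal_neq0.
- exact: (orth j).
- exact: (orth k).
- exact: (orth l).
Qed.

(** Each crinkle vertex C' is attached to A, E and D, and each D' to A, E and C.
    So the velocities come from the rigidity of the edges alone, without
    differentiating the root of the quadratic equation. *)
Lemma velocities i : (i < 15)%N -> velocity (fun t => p t i) = rvec (corner rates i).
Proof.
have vfix j : j \in fixed_vertices -> vel j = rvec (corner rates j).
  move=> fj; have -> : vel j = 0.
    apply/rowP => k; rewrite [LHS]mxE [RHS]mxE (_ : (fun t => _) = cst (rvec (corner points j) 0 k)).
      exact: derive_cst.
    by apply/funext => t; rewrite pfixed.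
  have -> : corner rates j = (Z0, Z0, Z0).
    by move: fj; rewrite !inE => /or4P[/eqP->|/eqP->|/eqP->|/orP[]/eqP->].
  by apply: row3P; rewrite row3E [LHS]mxE zreal0.
have v7 : vel 7 = rvec (corner rates 7).
  exact: (@vel_unique 7 2 3 1 isT isT isT isT isT isT isT (vfix 2 isT) v3 (vfix 1 isT) isT).
have v8 : vel 8 = rvec (corner rates 8).
  exact: (@vel_unique 8 2 3 0 isT isT isT isT isT isT isT (vfix 2 isT) v3 (vfix 0 isT) isT).
have v9 : vel 9 = rvec (corner rates 9).
  exact: (@vel_unique 9 4 3 1 isT isT isT isT isT isT isT (vfix 4 isT) v3 (vfix 1 isT) isT).
have v10 : vel 10 = rvec (corner rates 10).
  exact: (@vel_unique 10 4 3 0 isT isT isT isT isT isT isT (vfix 4 isT) v3 (vfix 0 isT) isT).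
have v11 : vel 11 = rvec (corner rates 11).
  exact: (@vel_unique 11 2 6 5 isT isT isT isT isT isT isT (vfix 2 isT) v6 (vfix 5 isT) isT).
have v12 : vel 12 = rvec (corner rates 12).
  exact: (@vel_unique 12 2 6 4 isT isT isT isT isT isT isT (vfix 2 isT) v6 (vfix 4 isT) isT).
have v13 : vel 13 = rvec (corner rates 13).
  exact: (@vel_unique 13 0 6 5 isT isT isT isT isT isT isT (vfix 0 isT) v6 (vfix 5 isT) isT).
have v14 : vel 14 = rvec (corner rates 14).
  exact: (@vel_unique 14 0 6 4 isT isT isT isT isT isT isT (vfix 0 isT) v6 (vfix 4 isT) isT).
move: i; do 3 (case=> [_|]; first exact: vfix).
case=> [_|]; first exact: v3.
do 2 (case=> [_|]; first exact: vfix).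
case=> [_|]; first exact: v6.
case=> [_|]; first exact: v7.
case=> [_|]; first exact: v8.
case=> [_|]; first exact: v9.
case=> [_|]; first exact: v10.
case=> [_|]; first exact: v11.
case=> [_|]; first exact: v12.
case=> [_|]; first exact: v13.
case=> [_|]; first exact: v14.
by [].
Qed.

Lemma is_derive_distance i j : (i < 15)%N -> (j < 15)%N ->
  is_derive (0 : R) 1 (fun t => sqdist (p t i) (p t j)) (2 * zreal (stretch i j)).
Proof.
move=> i15 j15; have := is_derive_sqdist (sp i) (sp j).
by rewrite !p0 // !velocities // !rvecB rvec_dot.
Qed.

End Velocities.

Section Diameter.
Context {R : realType} {m n : nat}.

(** A difference of convex combinations is a convex combination of differences,
    so the diameter is attained at vertices. *)
Lemma plmap_diameter (p : 'I_m -> 'rV[R]_n) (d : R) (s s' : {set 'I_m}) x y :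
  0 <= d -> (forall i j, sqdist (p i) (p j) <= d ^+ 2) ->
  simplex s x -> simplex s' y -> sqdist (plmap p x) (plmap p y) <= d ^+ 2.
Proof.
move=> d0 pd [x0 x1 _] [y0 y1 _]; rewrite /sqdist; set z := _ - _.
have zE : z = \sum_i \sum_j (x 0 i * y 0 j) *: (p i - p j).
  under eq_bigr do under eq_bigr do rewrite scalerBr.
  under eq_bigr do rewrite sumrB -scaler_suml -mulr_sumr y1 mulr1.
  rewrite sumrB exchange_big; congr (_ - _); apply: eq_bigr => j _.
  by rewrite -scaler_suml -mulr_suml x1 mul1r.
have le : dot z z <= enorm z * d.
  rewrite {1}zE dot_suml.
  apply: (@le_trans _ _ (\sum_i x 0 i * (enorm z * d))); last by rewrite -mulr_suml x1 mul1r.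
  apply: ler_sum => i _; rewrite dot_suml.
  apply: (@le_trans _ _ (\sum_j x 0 i * y 0 j * (enorm z * d))); last first.
    by rewrite -mulr_suml -mulr_sumr y1 mulr1.
  apply: ler_sum => j _; rewrite dotZl ler_wpM2l ?mulr_ge0 //.
  apply: le_trans (dot_le_enorm _ _) _; rewrite mulrC ler_wpM2l ?enorm_ge0 //.
  by rewrite -(@ler_pXn2r _ 2) ?nnegrE ?enorm_ge0 // sqr_enorm pd.
rewrite -sqr_enorm in le *; rewrite ler_pXn2r ?nnegrE ?enorm_ge0 //.
have [->//|z0] := eqVneq (enorm z) 0.
by rewrite -(@ler_pM2l _ (enorm z)) -?expr2 // lt_def z0 enorm_ge0.
Qed.

End Diameter.

(** * The flexible polyhedron *)

Section Final.
Context {R : realType}.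

Lemma near_seq (T : eqType) (s : seq T) (P : T -> R -> Prop) :
  (forall e, e \in s -> \forall t \near (0 : R), P e t) ->
  \forall t \near (0 : R), forall e, e \in s -> P e t.
Proof.
elim: s => [_|e s IHs sP]; first by near=> t.
have eP := sP e (mem_head _ _).
have /IHs {}IHs : forall e', e' \in s -> \forall t \near (0 : R), P e' t.
  by move=> e' es; apply: sP; rewrite inE es orbT.
apply: filterS (filterI eP IHs) => t [et st] e'; rewrite inE => /orP[/eqP->//|].
exact: st.
Unshelve. all: by end_near. Qed.

Lemma nondegenerate_sqdist m n (p q : 'I_m -> 'rV[R]_n) (s : {set 'I_m}) :
  (forall v w, v \in s -> w \in s -> sqdist (p v) (p w) = sqdist (q v) (q w)) ->
  nondegenerate p s -> nondegenerate q s.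
Proof.
move=> e [a [b [c [sE u g0]]]]; exists a, b, c; split=> //.
have [aS bS cS] : [/\ a \in s, b \in s & c \in s] by rewrite sE !inE !eqxx !orbT.
suff <- : gram (p b - p a) (p c - p a) = gram (q b - q a) (q c - q a) by [].
by rewrite /gram !polarization !(e _ _ _ aS) // !(e _ _ bS) // !(e _ _ cS).
Qed.

Lemma triangle_corners (v w a : 'I_15) : [set v; w; a]%SET \in double_steffen ->
  exists2 t, t \in faces & [/\ (v : nat) \in corners t, (w : nat) \in corners t &
                               (a : nat) \in corners t].
Proof.
move=> /complexP[t tF e]; exists t => //.
have inT i : i \in [set v; w; a]%SET -> (i : nat) \in corners t by rewrite e inE.
by split; apply: inT; rewrite !inE eqxx ?orbT.
Qed.

Lemma triangle_gram (v w a : nat) t : t \in faces ->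
  v \in corners t -> w \in corners t -> a \in corners t -> uniq [:: v; w; a] ->
  gram (rvec (corner points w) - rvec (corner points v))
       (rvec (corner points a) - rvec (corner points v) : 'rV[R]_3) != 0.
Proof.
move=> tF vt wt at_ u; rewrite !rvecB rvec_gram; apply: zreal_neq0.
have : all (fun t => all (fun v => all (fun w => all (fun a =>
    uniq [:: v; w; a] ==> ~~ Z.eqb (igram (isub (corner points w) (corner points v))
      (isub (corner points a) (corner points v))) 0)
  (corners t)) (corners t)) (corners t)) faces by vm_compute.
by move=> /allP/(_ _ tF)/allP/(_ _ vt)/allP/(_ _ wt)/allP/(_ _ at_)/implyP/(_ u).
Qed.

(** For every edge vw, the distance of the two opposite vertices changes to first
    order. At the edge AB of Steffen's polyhedron it would not. *)
Lemma opposite_rate (v w a b : nat) t t' : t \in faces -> t' \in faces ->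
  v \in corners t -> w \in corners t -> a \in corners t ->
  v \in corners t' -> w \in corners t' -> b \in corners t' ->
  uniq [:: v; w; a; b] -> ~~ Z.eqb (stretch a b) 0.
Proof.
move=> tF t'F vt wt at_ vt' wt' bt' u.
have : all (fun t => all (fun t' => all (fun v => (v \in corners t') ==>
    all (fun w => (w \in corners t') ==> all (fun a => all (fun b =>
      uniq [:: v; w; a; b] ==> ~~ Z.eqb (stretch a b) 0)
    (corners t')) (corners t)) (corners t)) (corners t)) faces) faces by vm_compute.
move=> /allP/(_ _ tF)/allP/(_ _ t'F)/allP/(_ _ vt)/implyP/(_ vt').
by move=> /allP/(_ _ wt)/implyP/(_ wt')/allP/(_ _ at_)/allP/(_ _ bt')/implyP/(_ u).
Qed.

Lemma diameter_points i j : (i < 15)%N -> (j < 15)%N ->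
  sqdist (rvec (corner points i)) (rvec (corner points j) : 'rV[R]_3) <=
  sqdist (rvec (corner points 6)) (rvec (corner points 3)).
Proof.
move=> i15 j15; rewrite /sqdist !rvecB !rvec_dot zreal_le.
have : all (fun i => all (fun j =>
    Z.leb (idot (isub (corner points i) (corner points j)) (isub (corner points i) (corner points j)))
    (idot (isub (corner points 6) (corner points 3)) (isub (corner points 6) (corner points 3))))
  (iota 0 15)) (iota 0 15) by vm_compute.
by move=> /allP/(_ i)/[!mem_iota]/(_ i15)/allP/(_ j)/[!mem_iota]/(_ j15).
Qed.

Lemma vertex_realization (i : 'I_15) t : t \in faces -> (i : nat) \in corners t ->
  realization double_steffen (@vertex R 15 i).
Proof.
move=> tF it; exists (triangle 15 t); first by apply/complexP; exists t.
by apply: simplex_vertex; rewrite inE.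
Qed.

End Final.

Theorem theorem1 (R : realType) :
  exists (m : nat) (K : {set {set 'I_m}}) (f : 'rV[R]_m -> 'rV[R]_3),
    [/\ polyhedron K f,
        no_self_intersections K f,
        homeomorphic (f @` realization K) (@unit_sphere R) &
        exists (alpha beta : R) (F : R -> 'rV[R]_m -> 'rV[R]_3),
          flex K f alpha beta F /\
          forall v w a b : 'I_m, edge_between K v w a b ->
            ~ dihedral_angle_constant alpha beta F v w a b].
Proof.
pose q0 := @place R points.
have nd0 := @points_nondegenerate R.
have surf : surface_with_boundary (@realization R 15 double_steffen).
  exact: sphere_surface complex_sphere.
exists 15%N, double_steffen, (plmap q0); split.
- exact: plmap_polyhedron.
- exact: points_embedded.
- apply: homeomorphic_trans complex_sphere; apply: homeomorphic_sym.
  apply: compact_inj_homeomorphic; [exact: 0|exact: norm_hausdorff| | |].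
  + exact: realization_compact.
  + by apply: continuous_subspaceT => x; exact: plmap_continuous.
  + exact: points_embedded.
have [p [sp p0 prigid pfixed [v3 v6]]] := @motion_exists R.
pose q t (i : 'I_15) := p t i.
have q00 : q 0 = q0 by apply/funext => i; rewrite /q p0.
have dpq := is_derive_distance sp p0 prigid pfixed v3 v6.
(* The flex is restricted to the times at which |EG| has increased, all edges
   are rigid and all vertices move continuously. *)
have [d1 d1_gt0 d1P] : exists2 d : R, 0 < d & forall t, 0 < t < d ->
    sqdist (p 0 6) (p 0 3) < sqdist (p t 6) (p t 3).
  apply: is_derive_gt0 (dpq 6 3 isT isT) _.
  by rewrite mulr_gt0 // -zreal0 zreal_lt.
have near : \forall t \near (0 : R),
    (forall e, e \in edges -> sqdist (p t e.1) (p t e.2) = sqdist (p 0 e.1) (p 0 e.2)) /\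
    (forall i, i \in iota 0 15 -> continuous_at t (fun t => p t i)).
  apply: filterI; first by apply: near_seq => -[i j] /prigid.
  by apply: near_seq => i _; exact: vsmooth_continuous.
have [d2 d2_gt0 d2P] := (nbhs_ballP _ _).1 near.
pose beta := Num.min d1 d2.
have beta_gt0 : 0 < beta by rewrite lt_min d1_gt0 /=; exact: d2_gt0.
have inball t : 0 <= t < beta -> ball (0 : R) d2 t.
  move=> /andP[t0 tb]; rewrite /ball /= sub0r normrN ger0_norm //.
  by rewrite (lt_le_trans tb) // ge_min lexx orbT.
have lengths t s v w : 0 <= t < beta -> s \in double_steffen -> v \in s -> w \in s ->
    sqdist (q0 v) (q0 w) = sqdist (q t v) (q t w).
  move=> /inball/d2P[e _] /complexP[tr trF ->]; rewrite !in_triangle -q00 => vt wt.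
  have [|[/e|/e]] := face_edges trF vt wt; rewrite /q /=.
  - by move=> ->; rewrite /sqdist !subrr.
  - by move=> ->.
  - by rewrite !(sqdistC _ (p _ w)) => ->.
have nd t s : 0 <= t < beta -> s \in double_steffen -> nondegenerate (q t) s.
  move=> tb sK; apply: nondegenerate_sqdist (nd0 _ sK) => v w vs ws.
  exact: lengths tb sK vs ws.
exists 0, beta, (fun t => plmap (q t)); split; last first.
  move=> v w a b [uvwab vwa vwb] const.
  have [t tF [vt wt at_]] := triangle_corners vwa.
  have [t' t'F [vt' wt' bt']] := triangle_corners vwb.
  have uvwab' : uniq [:: v : nat; w : nat; a : nat; b : nat].
    by rewrite -(map_inj_uniq val_inj) in uvwab.
  have [uva uvb] : uniq [:: v : nat; w : nat; a : nat] /\ uniq [:: v : nat; w : nat; b : nat].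
    move: uvwab'; rewrite /= !inE !negb_or.
    by move=> /and4P[/and3P[-> -> ->] /andP[-> ->] _ _].
  have /(is_derive_neq0 (dpq a b (ltn_ord a) (ltn_ord b))) [d d_gt0 dP] :
      2 * zreal (stretch a b) != 0 :> R.
    rewrite mulf_neq0 ?pnatr_eq0 //; apply: zreal_neq0.
    exact: (opposite_rate tF t'F vt wt at_ vt' wt' bt').
  pose x := Num.min d beta / 2.
  have m_gt0 : 0 < Num.min d beta by rewrite lt_min d_gt0.
  have x_gt0 : 0 < x by rewrite divr_gt0.
  have xm : x < Num.min d beta by rewrite /x; lra.
  have xb : 0 <= x < beta by rewrite ltW //= (lt_le_trans xm) // ge_min lexx orbT.
  have xd : 0 < x < d by rewrite x_gt0 (lt_le_trans xm) // ge_min lexx.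
  have len := lengths x _ _ _ xb.
  have /eqP := dP x xd; apply; apply/esym.
  have vS : v \in [set v; w; a]%SET by rewrite !inE eqxx.
  have wS : w \in [set v; w; a]%SET by rewrite !inE eqxx orbT.
  have aS : a \in [set v; w; a]%SET by rewrite !inE eqxx orbT.
  have vS' : v \in [set v; w; b]%SET by rewrite !inE eqxx.
  have wS' : w \in [set v; w; b]%SET by rewrite !inE eqxx orbT.
  have bS' : b \in [set v; w; b]%SET by rewrite !inE eqxx orbT.
  rewrite -[p 0 a]/(q 0 a) -[p 0 b]/(q 0 b) q00 -[p x a]/(q x a) -[p x b]/(q x b).
  apply: (@dihedral_angle_distance R 15 q0 (q x) v w a b).
  - exact: (triangle_gram tF).
  - exact: (triangle_gram t'F).
  - exact: len vwa vS wS.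
  - exact: len vwa vS aS.
  - exact: len vwa wS aS.
  - exact: len vwb vS' bS'.
  - exact: len vwb wS' bS'.
  - by rewrite -q00; apply: const => //; rewrite lexx.
split=> //.
- by move=> x _; rewrite q00.
- by move=> t tb; apply: plmap_polyhedron => // s sK; exact: nd.
- move=> x _; apply: continuous_in_subspaceT => t; rewrite inE /= in_itv /= => tb.
  have [_ ct] := d2P _ (inball _ tb).
  apply: continuous_at_sum => i; apply: for_continuousZ; first exact: for_continuous_cst.
  by apply: ct; rewrite mem_iota /=.
move=> t /andP[t0 tb]; have tb' : 0 <= t < beta by rewrite ltW.
rewrite q00; split.
  apply: plmap_faces_congruent => // s v w sK vs ws; exact: lengths tb' sK vs ws.
move=> [g giso gE].
(* A congruence would carry points x and y of the initial polyhedron to the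
   vertices 6 and 3, at a distance larger than the initial diameter. *)
have in15 (i : 'I_15) tr : tr \in faces -> (i : nat) \in corners tr ->
    exists2 x, realization double_steffen x & g (plmap q0 x) = q t i.
  move=> trF itr.
  have : (g @` (plmap q0 @` realization double_steffen)) (q t i).
    rewrite gE; exists (vertex i); last exact: plmap_vertex.
    exact: vertex_realization trF itr.
  by move=> [_ [x Kx <-] e]; exists x.
have [x Kx gx] := in15 (@Ordinal 15 6 isT) (12, 6, 4)%N isT isT.
have [y Ky gy] := in15 (@Ordinal 15 3 isT) (1, 3, 7)%N isT isT.
have [s sK sx] := Kx; have [s' s'K sy] := Ky.
have : sqdist (p 0 6) (p 0 3) < sqdist (p t 6) (p t 3).
  by apply: d1P; rewrite t0 (lt_le_trans tb) // ge_min lexx.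
rewrite -[p t 6]gx -[p t 3]gy.
have /edist_eq e := giso (plmap q0 x) (plmap q0 y).
rewrite {2}/sqdist e -/(sqdist _ _) ltNge => /negP; apply.
have dge0 := dot_ge0 (p 0 6 - p 0 3).
rewrite -[X in _ <= X]sqr_sqrtr //; apply: (plmap_diameter _ _ sx sy); first exact: sqrtr_ge0.
move=> i j; rewrite sqr_sqrtr // !p0 //; exact: diameter_points.
Qed.
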